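(* Let $d\in\mathbb{N}$, fix $\alpha\in\left(0,\frac1d\right)$ and $C>0$, and suppose that $1<pn^\alpha<C$ for all sufficiently large $n$. Then for every $\varepsilon>0$ there exists $n_0$ such that for all $n\ge n_0$, $$u_d(n,p)\ge(2-2\alpha-\varepsilon)\frac{\ln n}{p}.$$
   Context: $G(n,p)$ is the Erdős–Rényi random graph on $n$ labelled vertices (vertex set $V$), each edge present independently with probability $p=p(n)$; $\mathbb{P}_{n,p}$ is the corresponding probability. A diameter graph in $\mathbb{R}^d$ is a graph $(V,E)$ with $V\subset\mathbb{R}^d$ finite and $E=\{\{\mathbf{x},\mathbf{y}\}\subseteq V: |\mathbf{x}-\mathbf{y}|=\operatorname{diam}V\}$, where $\operatorname{diam}V=\max_{\mathbf{x},\mathbf{y}\in V}|\mathbf{x}-\mathbf{y}|$ (Euclidean norm); a graph is a diameter graph in $\mathbb{R}^d$ if it is isomorphic to one. $u_d(n,p)$ is the largest positive integer $k$ such that $\mathbb{P}_{n,p}\big(\exists W\subseteq V,\ |W|=k,\ G[W]$ is a diameter graph in $\mathbb{R}^d$ and $\chi(G[W])=d+1\big)>\frac12$, where $G[W]$ is the induced subgraph; if no such $k$ exists, $u_d(n,p)=0$. *)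

(* Defs.v *)
From Stdlib Require Import Reals ClassicalEpsilon.
From mathcomp Require Import all_boot.
Local Open Scope R_scope.
Set Implicit Arguments. Unset Strict Implicit. Unset Printing Implicit Defensive.

Definition point (d : nat) := 'I_d -> R.

Definition edist (d : nat) (x y : point d) : R :=
  sqrt (\big[Rplus/0]_(i < d) Rsqr (x i - y i)).

(* Sample space of G(n,p): edge sets E of unordered pairs {i,j}, encoded
   as ordered pairs (i,j) with i < j. *)
Definition pairs (n : nat) : {set 'I_n * 'I_n} :=
  [set ij : 'I_n * 'I_n | (ij.1 < ij.2)%N].

Definition adj (n : nat) (E : {set 'I_n * 'I_n}) (x y : 'I_n) : bool :=
  ((x, y) \in E) || ((y, x) \in E).

Definition prob (n : nat) (p : R) (A : {set 'I_n * 'I_n} -> Prop) : R :=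
  \big[Rplus/0]_(E : {set 'I_n * 'I_n} | E \subset pairs n)
    (if excluded_middle_informative (A E)
     then (p ^ #|E| * (1 - p) ^ (#|pairs n| - #|E|)%N)
     else 0).

Definition is_diameter_graph (d n : nat) (E : {set 'I_n * 'I_n})
    (W : {set 'I_n}) : Prop :=
  exists (f : 'I_n -> point d) (D : R),
    (forall x y, x \in W -> y \in W -> f x = f y -> x = y) /\
    (forall x y, x \in W -> y \in W -> edist (f x) (f y) <= D) /\
    (exists x y, x \in W /\ y \in W /\ edist (f x) (f y) = D) /\
    (forall x y, x \in W -> y \in W -> x <> y ->
       (adj E x y <-> edist (f x) (f y) = D)).

Definition colorable (n : nat) (E : {set 'I_n * 'I_n}) (W : {set 'I_n})
    (k : nat) : Prop :=
  exists c : 'I_n -> nat,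
    (forall x, x \in W -> (c x < k)%N) /\
    (forall x y, x \in W -> y \in W -> adj E x y -> c x <> c y).

Definition chromatic_number_is (n : nat) (E : {set 'I_n * 'I_n})
    (W : {set 'I_n}) (k : nat) : Prop :=
  colorable E W k /\ (forall j, (j < k)%N -> ~ colorable E W j).

Definition event_u (d n k : nat) (E : {set 'I_n * 'I_n}) : Prop :=
  exists W : {set 'I_n}, #|W| = k /\ is_diameter_graph d E W /\
                         chromatic_number_is E W d.+1.

Definition Rltb (a b : R) : bool := if Rlt_dec a b then true else false.

(* u_d(n,p): the largest positive k with P(event) > 1/2, or 0 if none.
   (Necessarily k <= n since W is a subset of the n vertices.) *)
Definition u (d n : nat) (p : R) : nat :=
  (\max_(k < n.+1 | (0 < k)%N && Rltb (1/2) (@prob n p (@event_u d n k))) k)%N.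

(* Main.v *)
(* In G(n,p) with p of order n^-alpha we look for a clique K on d+1 vertices and
   an independent set I of m ~ (2-2alpha-eps) ln n / p vertices with no edge
   between K and I.  Placing K at the vertices of a regular simplex of side
   sqrt 2 in R^d and I on a short segment inside it realises G[K u I] as a
   diameter graph of chromatic number d+1.

   K is found greedily: since alpha < 1/d, every set of at most d vertices has
   many common neighbours in a fresh set of n/(4d) vertices.  By Markov's
   inequality, at least half of the remaining vertices are not adjacent to K,
   and I is sought among them.  The second moment method bounds
   P(there is an independent m-set) from below by the inverse of
     Sum_l P(|I n J| = l) (1-p)^-C(l,2),   I, J uniform random m-sets;
   this is close to 1 for alpha <= 3/5.  For alpha > 3/5 it only gives
   exp(-O(n^(2alpha-1))), for a slightly larger m; but the independence number
   changes by at most 1 when the edges at one vertex are resampled, and a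
   bounded-differences inequality turns this into probability close to 1, at
   the cost of lowering m by O(n^alpha) = O(1/p) = o(ln n / p).

   Asymptotics are taken in L = ln n. *)
Require Import Defs.
From Stdlib Require Import Reals Lra ClassicalEpsilon.
From mathcomp Require Import all_boot all_order all_algebra.
From mathcomp Require Import zify.
From mathcomp Require Import Rstruct.
Set Implicit Arguments. Unset Strict Implicit. Unset Printing Implicit Defensive.
Import Order.TTheory GRing.Theory Num.Theory.
Local Open Scope ring_scope.

Section FiniteProbability.
From mathcomp Require Import ring lra.

(** * Expectation and probability for a random subset of a finite set *)

Section RandomSubset.
Variables (R : realFieldType) (T : finType) (p : R).
Implicit Types (S A B E F : {set T}) (f g : {set T} -> R) (P Q : pred {set T}).

(** Each element of [S] is kept independently with probability [p]. The ground set [S] is an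
    argument so that disjoint sets of pairs can be exposed one after another. *)
Definition Ex S f : R :=
  \sum_(E : {set T} | E \subset S)
    p ^+ #|E| * (1 - p) ^+ (#|S| - #|E|) * f E.

Definition Pr S P : R := Ex S (fun E => (P E)%:R).

Lemma eq_Ex S f g : (forall E, E \subset S -> f E = g E) -> Ex S f = Ex S g.
Proof. by move=> fg; apply: eq_bigr => E /fg ->. Qed.

Lemma ExD S f g : Ex S (fun E => f E + g E) = Ex S f + Ex S g.
Proof. by rewrite -big_split; apply: eq_bigr => E _; rewrite mulrDr. Qed.

Lemma ExZ S c f : Ex S (fun E => c * f E) = c * Ex S f.
Proof. by rewrite /Ex big_distrr; apply: eq_bigr => E _; rewrite mulrCA. Qed.

Lemma ExZr S c f : Ex S (fun E => f E * c) = Ex S f * c.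
Proof. by rewrite mulrC -ExZ; apply: eq_Ex => E _; rewrite mulrC. Qed.

Lemma Ex_sum (I : Type) (r : seq I) (D : pred I) S (f : I -> {set T} -> R) :
  Ex S (fun E => \sum_(i <- r | D i) f i E) = \sum_(i <- r | D i) Ex S (f i).
Proof.
by rewrite exchange_big; apply: eq_bigr => E _; rewrite big_distrr.
Qed.

(** Fubini: the traces of a random set on disjoint sets are independent, and a subset of the union
    is the same as a pair of traces. *)
Lemma Ex_setU A B f : [disjoint A & B] ->
  Ex (A :|: B) f = Ex A (fun E => Ex B (fun F => f (E :|: F))).
Proof.
move=> dAB; rewrite /Ex.
under [RHS]eq_bigr do rewrite big_distrr /=.
rewrite pair_big_dep /=.
rewrite (reindex_onto (fun u : {set T} * {set T} => u.1 :|: u.2)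
                      (fun E => (E :&: A, E :&: B))) /=; last first.
  by move=> E sE; rewrite -setIUr; apply/setIidPl.
apply: eq_big => [[E F]|[E F] /=].
  rewrite /= xpair_eqE; apply/idP/idP.
    by case/andP=> _ /andP[/eqP <- /eqP <-]; rewrite !subsetIr.
  case/andP=> sE sF; rewrite setUSS //=.
  rewrite !setIUl (setIidPl sE) (setIidPl sF).
  have -> : F :&: A = set0.
    by apply: disjoint_setI0; rewrite disjoint_sym; apply: disjointWr dAB.
  have -> : E :&: B = set0 by apply: disjoint_setI0; apply: disjointWl dAB.
  by rewrite setU0 set0U !eqxx.
case/andP=> _; rewrite xpair_eqE => /andP[/eqP eE /eqP eF].
have sE : E \subset A by rewrite -eE subsetIr.
have sF : F \subset B by rewrite -eF subsetIr.
have dEF : E :&: F = set0.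
  by apply: disjoint_setI0; apply: disjointWl sE _; apply: disjointWr sF _.
have dAB0 := disjoint_setI0 dAB.
rewrite !cardsU dEF dAB0 cards0 !subn0.
have cE := subset_leq_card sE; have cF := subset_leq_card sF.
have -> : (#|A| + #|B| - (#|E| + #|F|) = (#|A| - #|E|) + (#|B| - #|F|))%N.
  by rewrite subnDA addnC -addnBA // addnC addnBA.
by rewrite !exprD; ring.
Qed.

Lemma Ex_set0 f : Ex set0 f = f set0.
Proof.
rewrite /Ex (big_pred1 set0) => [|E]; last by rewrite subset0.
by rewrite cards0 !expr0 !mul1r.
Qed.

Lemma Ex_set1 x f : Ex [set x] f = p * f [set x] + (1 - p) * f set0.
Proof.
rewrite /Ex (bigD1 [set x]) //= (big_pred1 set0) => [|E].
  by rewrite cards1 cards0 subnn subn0 !expr0 !expr1 mul1r mulr1.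
by rewrite subset1 /= andb_orl andbN /= andb_idr // => /eqP ->; rewrite eq_sym -card_gt0 cards1.
Qed.

Lemma Ex_cst S c : Ex S (fun=> c) = c.
Proof.
elim: {S}_.+1 {-2}S (ltnSn #|S|) => // k IH S; rewrite ltnS => leS.
case: (set_0Vmem S) => [->|[x xS]]; first exact: Ex_set0.
rewrite -(setD1K xS) Ex_setU; last by rewrite disjoints1 in_setD1 eqxx.
have leS' : (#|S :\ x| < k)%N by rewrite (cardsD1 x S) xS in leS.
rewrite (eq_Ex (g := fun=> c)) => [|E _]; last exact: IH.
by rewrite Ex_set1; ring.
Qed.

Lemma disjoint_setD S A : [disjoint A & S :\: A].
Proof. by apply/pred0P => x /=; rewrite !inE; case: (x \in A). Qed.

Lemma Ex_setI S A f : A \subset S -> Ex S (fun E => f (E :&: A)) = Ex A f.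
Proof.
move=> sAS; rewrite -{1}(setID S A) (setIidPr sAS) Ex_setU ?disjoint_setD //.
apply: eq_Ex => E sE; rewrite -[RHS](Ex_cst (S :\: A)).
apply: eq_Ex => F sF; rewrite setIUl (setIidPl sE).
suff -> : F :&: A = set0 by rewrite setU0.
apply/eqP; rewrite setI_eq0 (disjointWl sF) // disjoint_sym.
exact: disjoint_setD.
Qed.

Lemma Ex_mul_setI A B f g : [disjoint A & B] ->
  Ex (A :|: B) (fun E => f (E :&: A) * g (E :&: B)) = Ex A f * Ex B g.
Proof.
move=> dAB; rewrite Ex_setU // -ExZr; apply: eq_Ex => E sE.
rewrite -ExZ; apply: eq_Ex => F sF; rewrite !setIUl (setIidPl sE) (setIidPl sF).
have -> : F :&: A = set0.
  by apply: disjoint_setI0; rewrite disjoint_sym; apply: disjointWr dAB.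
have -> : E :&: B = set0 by apply: disjoint_setI0; apply: disjointWl dAB.
by rewrite setU0 set0U.
Qed.

Lemma Pr_superset S B : B \subset S -> Pr S (fun E => B \subset E) = p ^+ #|B|.
Proof.
move=> sBS; rewrite /Pr.
rewrite (eq_Ex (g := fun E => (B \subset E :&: B)%:R)); last first.
  by move=> E _; rewrite subsetI subxx andbT.
rewrite (Ex_setI (fun E => (B \subset E)%:R)) // /Ex (bigD1 B) //=.
rewrite subxx subnn mulr1 mulr1 big1 ?addr0 // => E /andP[sE nE].
by rewrite eqEsubset sE /= in nE; rewrite (negPf nE) mulr0.
Qed.

Lemma Pr_avoid S B :
  B \subset S -> Pr S (fun E => [disjoint E & B]) = (1 - p) ^+ #|B|.
Proof.
move=> sBS; rewrite /Pr.
rewrite (eq_Ex (g := fun E => (E :&: B == set0)%:R)); last first.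
  by move=> E _; rewrite setI_eq0.
rewrite (Ex_setI (fun E => (E == set0)%:R)) // /Ex (bigD1 set0) ?sub0set //=.
rewrite cards0 eqxx subn0 expr0 mul1r mulr1 big1 ?addr0 // => E /andP[sE nE].
by rewrite (negPf nE) mulr0.
Qed.

Hypotheses (p_ge0 : 0 <= p) (p_le1 : p <= 1).

Lemma wt_ge0 S E : 0 <= p ^+ #|E| * (1 - p) ^+ (#|S| - #|E|).
Proof. by rewrite mulr_ge0 // exprn_ge0 // subr_ge0. Qed.

Lemma le_Ex S f g :
  (forall E, E \subset S -> f E <= g E) -> Ex S f <= Ex S g.
Proof. by move=> fg; apply: ler_sum => E sE; rewrite ler_wpM2l ?wt_ge0 ?fg. Qed.

Lemma Ex_ge0 S f : (forall E, E \subset S -> 0 <= f E) -> 0 <= Ex S f.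
Proof. by move=> f0; apply: sumr_ge0 => E sE; rewrite mulr_ge0 ?wt_ge0 ?f0. Qed.

Lemma Pr_ge0 S P : 0 <= Pr S P.
Proof. by apply: Ex_ge0 => E _; rewrite ler0n. Qed.

Lemma le_Pr S P Q : (forall E, E \subset S -> P E -> Q E) -> Pr S P <= Pr S Q.
Proof.
move=> PQ; apply: le_Ex => E sE; rewrite ler_nat.
by case: (P E) (PQ E sE) => // ->.
Qed.

Lemma PrC S P : Pr S (fun E => ~~ P E) = 1 - Pr S P.
Proof.
apply/(canRL (addrK _)); rewrite -ExD -[RHS](Ex_cst S).
by apply: eq_Ex => E _; case: (P E); rewrite ?addr0 ?add0r.
Qed.

(** [A] is exposed first. The bound [b] on the second stage is required for every favourable outcome
    of the first, in place of a conditional probability. *)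
Lemma Pr_setU A B P Q (a b : R) : [disjoint A & B] -> 0 <= b ->
  a <= Pr A P ->
  (forall E, E \subset A -> P E -> b <= Pr B (fun F => Q (E :|: F))) ->
  a * b <= Pr (A :|: B) Q.
Proof.
move=> dAB b0 aP bQ; rewrite /Pr Ex_setU //.
apply: le_trans (ler_wpM2r b0 aP) _; rewrite -ExZr; apply: le_Ex => E sE.
have [PE|_] := boolP (P E); last by rewrite mul0r; exact: Pr_ge0.
by rewrite mul1r; exact: bQ.
Qed.

Lemma Ex_markov S P f (c : R) : (forall E, E \subset S -> 0 <= f E) ->
  (forall E, E \subset S -> ~~ P E -> c <= f E) -> c * (1 - Pr S P) <= Ex S f.
Proof.
move=> f0 Pf; rewrite -PrC -ExZ; apply: le_Ex => E sE.
by have [PE|PE] := boolP (P E); rewrite ?mulr0 ?mulr1; [exact: f0|exact: Pf].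
Qed.

(* Expand [0 <= Ex (X - t 1_P)^2] at [t = Ex X^2 / Ex X]. *)
Lemma second_moment S P f : 0 < Ex S f ->
  (forall E, E \subset S -> ~~ P E -> f E = 0) ->
  (Ex S f) ^+ 2 <= Pr S P * Ex S (fun E => f E ^+ 2).
Proof.
move=> f_gt0 fP; set m1 := Ex S f; set m2 := Ex S _; set P0 := Pr S P.
have quad t : 0 <= m2 - 2 * t * m1 + t ^+ 2 * P0.
  have -> : m2 - 2 * t * m1 + t ^+ 2 * P0 = Ex S (fun E => (f E - t * (P E)%:R) ^+ 2).
    rewrite /m1 /m2 /P0 /Pr -mulNr -!ExZ -!ExD; apply: eq_Ex => E sE.
    have [_|PE] := boolP (P E); first by rewrite /=; ring.
    by rewrite (fP E sE PE) /=; ring.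
  by apply: Ex_ge0 => E _; exact: sqr_ge0.
have m2_ge0 : 0 <= m2 by apply: Ex_ge0 => E _; exact: sqr_ge0.
have m1_neq0 : m1 != 0 by rewrite gt_eqF.
have := quad (m2 / m1).
have -> : m2 - 2 * (m2 / m1) * m1 + (m2 / m1) ^+ 2 * P0
        = (P0 * m2 - m1 ^+ 2) * (m2 / m1 ^+ 2) by field.
(* If the second moment vanishes, the chosen t is 0 and gives nothing. Then t = [m1] yields 0 <= -2
   m1^2 + m1^2 P0, which is absurd as [P0] <= 1. *)
have [m2_0|m2_neq0] := eqVneq m2 0.
  have P01 : P0 <= 1 by rewrite -subr_ge0 -PrC Pr_ge0.
  have := quad m1; rewrite m2_0; have : 0 < m1 ^+ 2 by rewrite exprn_gt0.
  by nra.
rewrite pmulr_lge0 ?subr_ge0 // divr_gt0 ?exprn_gt0 //.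
by rewrite lt_def m2_neq0.
Qed.

(* For [f] in [[a, r a]] we have [(f - a) (r a - f) >= 0]; divide by [f], take
   expectations and apply AM-GM. *)
Lemma kantorovich S f g (a r c : R) : 0 < a -> 1 <= r -> 0 <= c ->
  (forall E, E \subset S -> a <= f E <= r * a) ->
  (forall E, E \subset S -> f E * g E <= c) ->
  Ex S f * Ex S g <= (1 + r) ^+ 2 / (4 * r) * c.
Proof.
move=> a0 r1 c0 fa fg.
have r0 : 0 < r by apply: lt_le_trans ltr01 r1.
have H : c * Ex S f + r * a ^+ 2 * Ex S g <= (1 + r) * a * c.
  rewrite -!ExZ -ExD -[leRHS](Ex_cst S); apply: le_Ex => E sE.
  have /andP[f1 f2] := fa E sE; have fg1 := fg E sE.
  have f0 : 0 < f E by apply: lt_le_trans f1.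
  rewrite -(ler_pM2l f0).
  have : r * a ^+ 2 * (f E * g E) <= r * a ^+ 2 * c.
    by rewrite ler_wpM2l // mulr_ge0 ?ltW // exprn_gt0.
  have : 0 <= c * ((f E - a) * (r * a - f E)).
    by rewrite !mulr_ge0 ?subr_ge0.
  by nra.
set x := Ex S f in H *; set y := Ex S g in H *.
have [c00|c_neq0] := eqVneq c 0.
  have x0 : 0 <= x by apply: Ex_ge0 => E /fa/andP[+ _]; apply: le_trans (ltW a0).
  rewrite c00 mulr0; rewrite c00 mul0r mulr0 add0r in H.
  have ra : 0 < r * a ^+ 2 by rewrite mulr_gt0 ?exprn_gt0.
  rewrite pmulr_rle0 // in H.
  by rewrite mulr_ge0_le0.
have cp : 0 < c by rewrite lt_def c_neq0.
have r1_gt0 : 0 <= 1 + r by rewrite addr_ge0 // ltW.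
have x0 : 0 < x.
  apply: lt_le_trans a0 _; rewrite -(Ex_cst S a); apply: le_Ex => E sE.
  by have /andP[] := fa E sE.
have [y0|y0] := lerP y 0.
  apply: le_trans (mulr_ge0_le0 (ltW x0) y0) _.
  by rewrite !mulr_ge0 ?sqr_ge0 ?invr_ge0 ?mulr_ge0 // ltW.
have H2 : (c * x + r * a ^+ 2 * y) ^+ 2 <= ((1 + r) * a * c) ^+ 2.
  rewrite ler_sqr // nnegrE.
    by rewrite addr_ge0 // !mulr_ge0 ?exprn_ge0 // ltW.
  by rewrite !mulr_ge0 // ltW.
have H3 : 4 * (c * x) * (r * a ^+ 2 * y) <= ((1 + r) * a * c) ^+ 2.
  apply: le_trans H2; rewrite -subr_ge0.
  by have -> : forall u v : R, (u + v) ^+ 2 - 4 * u * v = (u - v) ^+ 2;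
    [move=> u v; ring|exact: sqr_ge0].
have -> : (1 + r) ^+ 2 / (4 * r) * c = ((1 + r) * a * c) ^+ 2 / (4 * r * a ^+ 2 * c).
  by field; rewrite !gt_eqF //= ?exprn_gt0.
rewrite ler_pdivlMr; last by rewrite !mulr_gt0 ?exprn_gt0.
by apply: le_trans H3; rewrite le_eqVlt; apply/orP; left; apply/eqP; ring.
Qed.

(** * A bounded-differences inequality *)

Section BoundedDifferences.
Variables (V : finType) (key : T -> V) (S : {set T}) (f : {set T} -> nat) (r : R).
Hypothesis r_ge1 : 1 <= r.
Hypothesis f_lip : forall v E E',
  E \subset S -> E' \subset S ->
  E :\: [set e | key e == v] = E' :\: [set e | key e == v] ->
  (f E <= f E' + 1)%N.

(* Bounding the product of the two exponential moments avoids centring [f];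
   the blocks are integrated out one at a time with [kantorovich]. *)
Lemma bounded_differences_seq (vs : seq V) F : uniq vs ->
  let S' := [set e in S | key e \in vs] in
  F \subset S ->
  Ex S' (fun E => r ^+ f (F :|: E)) * Ex S' (fun E => r ^- f (F :|: E))
    <= ((1 + r) ^+ 2 / (4 * r)) ^+ size vs.
Proof.
have r0 : 0 < r by apply: lt_le_trans ltr01 r_ge1.
elim: vs F => [|v vs IH] F /=.
  move=> _ sF; have -> : [set e in S | key e \in [::]] = set0.
    by apply/setP => e; rewrite !inE andbF.
  by rewrite !Ex_set0 mulfV ?expf_neq0 ?gt_eqF.
case/andP=> nv uvs sF.
have -> : [set e in S | key e \in v :: vs]
    = [set e in S | key e == v] :|: [set e in S | key e \in vs].
  by apply/setP => e; rewrite !inE; case: (e \in S).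
rewrite !Ex_setU; try (apply/pred0P => e /=; rewrite !inE;
  by case: eqP => [->|]; rewrite ?(negPf nv) !andbF).
set S1 := [set e in S | key e == v]; set S2 := [set e in S | key e \in vs].
have sS1 : S1 \subset S by apply/subsetP => e; rewrite inE => /andP[].
have sS2 : S2 \subset S by apply/subsetP => e; rewrite inE => /andP[].
have lip E E' (G : {set T}) : E \subset S1 -> E' \subset S1 -> G \subset S2 ->
    (f (F :|: (E :|: G)) <= f (F :|: (E' :|: G)) + 1)%N.
  move=> sE sE' sG; apply: (f_lip (v := v)).
  - by rewrite !subUset sF (subset_trans sE) // (subset_trans sG).
  - by rewrite !subUset sF (subset_trans sE') // (subset_trans sG).
  have E0 (A : {set T}) : A \subset S1 -> A :\: [set e | key e == v] = set0.
    move=> sA; apply/eqP; rewrite setD_eq0 (subset_trans sA) //.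
    by apply/subsetP => e; rewrite !inE => /andP[].
  by rewrite !setDUl (E0 E) // (E0 E').
pose h E := Ex S2 (fun G => r ^+ f (F :|: (E :|: G))).
(* Integrating out the other blocks preserves the Lipschitz ratio [r], so the minimum of [h] over
   the block serves as the lower end a of the interval [a, r a] in [kantorovich]. *)
have hlip E E' : E \subset S1 -> E' \subset S1 -> h E <= r * h E'.
  move=> sE sE'; rewrite -ExZ; apply: le_Ex => G sG.
  by rewrite -exprS ler_weXn2l // -addn1 lip.
have h_gt0 E : 0 < h E.
  apply: lt_le_trans ltr01 _; rewrite -(Ex_cst S2 1); apply: le_Ex => G _.
  exact: exprn_ege1.
pose Em := [arg min_(E < set0 | E \subset S1) h E]%O.
have [sEm Emin] : Em \subset S1 /\ forall E, E \subset S1 -> h Em <= h E.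
  by rewrite /Em; case: arg_minP => [|E sE Emin]; [exact: sub0set|split].
rewrite exprS; apply: (@kantorovich _ _ _ (h Em)) => //.
- by rewrite exprn_ge0 // divr_ge0 ?sqr_ge0 // mulr_ge0 // ltW.
- by move=> E sE; rewrite Emin //= hlip.
move=> E sE; have := IH (F :|: E) uvs.
rewrite subUset sF (subset_trans sE) //= => /(_ isT); rewrite -/S2 /h.
by congr (_ * _ <= _); apply: eq_Ex => G _; rewrite setUA.
Qed.

(** Markov's inequality for [r ^+ f] bounds the upper tail and for [r ^- f] the lower one. In the
    product the powers with exponent [k] cancel and [r ^- t] remains. *)
Lemma bounded_differences (k t : nat) :
  Pr S (fun E => k + t <= f E)%N * Pr S (fun E => f E < k)%N
    <= ((1 + r) ^+ 2 / (4 * r)) ^+ #|V| / r ^+ t.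
Proof.
have r0 : 0 < r by apply: lt_le_trans ltr01 r_ge1.
have := bounded_differences_seq (F := set0) (enum_uniq V) (sub0set S).
have -> : [set e in S | key e \in enum V] = S.
  by apply/setP => e; rewrite inE mem_enum inE andbT.
rewrite -cardE => H; rewrite ler_pdivlMr ?exprn_gt0 //.
apply: le_trans H.
have H1 : r ^+ (k + t) * Pr S (fun E => k + t <= f E)%N
    <= Ex S (fun E => r ^+ f (set0 :|: E)).
  rewrite -ExZ; apply: le_Ex => E _; rewrite set0U.
  case: leqP => kf; rewrite ?mulr1 ?mulr0 ?exprn_ge0 ?(ltW r0) //.
  exact: ler_weXn2l.
have H2 : r ^- k * Pr S (fun E => f E < k)%N
    <= Ex S (fun E => r ^- f (set0 :|: E)).
  rewrite -ExZ; apply: le_Ex => E _; rewrite set0U.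
  case: leqP => kf; rewrite ?mulr1 ?mulr0 ?invr_ge0 ?exprn_ge0 ?(ltW r0) //.
  by rewrite lef_pV2 ?posrE ?exprn_gt0 // ler_weXn2l // ltnW.
apply: le_trans (ler_pM _ _ H1 H2); last first.
- by rewrite mulr_ge0 ?Pr_ge0 // invr_ge0 exprn_ge0 // ltW.
- by rewrite mulr_ge0 ?Pr_ge0 // exprn_ge0 // ltW.
rewrite exprD le_eqVlt; apply/orP; left; apply/eqP.
by field; rewrite expf_neq0 // gt_eqF.
Qed.
End BoundedDifferences.
End RandomSubset.

(** * Counting pairs and overlapping sets *)

Lemma card_pairs_setX n (I : {set 'I_n}) :
  #|pairs n :&: setX I I| = 'C(#|I|, 2).
Proof.
pose sw (e : 'I_n * 'I_n) := (e.2, e.1).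
have sw_inj : injective sw by move=> [a b] [c d] [-> ->].
(* The square of [I] splits into [P], its mirror image and the diagonal [D]. *)
set P := pairs n :&: _; set D := [set (x, x) | x in I].
have dPP : [disjoint P & sw @: P].
  apply/pred0P => -[x y]; rewrite /= !inE /=; apply/negbTE/negP.
  case/andP=> /andP[xy _] /imsetP[[a b]]; rewrite !inE /= => /andP[ab _] [ex ey].
  by rewrite ex ey ltnNge ltnW in xy.
have dPD : [disjoint P :|: sw @: P & D].
  apply/pred0P => e; rewrite /= in_setU; apply/negbTE/negP.
  case/andP=> eP /imsetP[x _ ex]; move: eP; rewrite {e}ex !inE /= ltnn /=.
  by case/imsetP=> -[a b]; rewrite !inE /= => /andP[ab _] [ea eb]; rewrite -ea -eb ltnn in ab.
have tot : P :|: sw @: P :|: D = setX I I.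
  apply/setP => -[x y]; rewrite !inE /=; apply/idP/idP.
    case/orP=> [/orP[/andP[_ //]|/imsetP[[a b]]]|/imsetP[z zI [-> ->]]]; last by rewrite zI.
    by rewrite !inE /= => /andP[_ /andP[aI bI]] [-> ->]; rewrite aI bI.
  move=> /andP[xI yI]; rewrite xI yI andbT.
  case: (ltngtP x y) => //= [yx|/val_inj xy].
    by apply/orP; left; apply/imsetP; exists (y, x); rewrite // !inE /= yx yI xI.
  by apply/orP; right; apply/imsetP; exists x; rewrite // xy.
have := congr1 (fun A : {set _} => #|A|) tot.
rewrite /= cardsU (disjoint_setI0 dPD) cardsU (disjoint_setI0 dPP) cards0 !subn0.
rewrite cardsX !card_imset //; last by move=> x y [].
move=> H; have {}H : (2 * #|P| = #|I| * #|I|.-1)%N.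
  by move: H; move: #|I| #|P| => [|i] k /=; lia.
by rewrite bin2 -H mul2n doubleK.
Qed.

Lemma setX_setI n (I J : {set 'I_n}) :
  (setX I I) :&: (setX J J) = setX (I :&: J) (I :&: J).
Proof. by apply/setP => -[x y]; rewrite !inE /= andbACA. Qed.

Lemma card_draws_superset (T : finType) (A L : {set T}) m : L \subset A ->
  (#|[set J : {set T} | (J \subset A) && (#|J| == m) & L \subset J]|
    <= 'C(#|A| - #|L|, m - #|L|))%N.
Proof.
move=> sLA; rewrite -(card_in_imset (f := fun J => J :\: L)) => [|J J'].
  have -> : (#|A| - #|L| = #|A :\: L|)%N by rewrite cardsD (setIidPr sLA).
  rewrite -cards_draws subset_leq_card //; apply/subsetP => _ /imsetP[J + ->].
  rewrite !inE => /andP[/andP[sJ /eqP cJ] sL].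
  by rewrite setSD //= cardsD (setIidPr sL) cJ.
rewrite !inE => /andP[_ sL] /andP[_ sL'] eJ.
by rewrite -(setID J L) -(setID J' L) eJ (setIidPr sL) (setIidPr sL').
Qed.

(** Each increase of [l] multiplies the binomial by (m - l) / (N - l) <= m / N. Hence a random m-set
    contains a given l-set with probability at most (m / N)^l. *)
Lemma bin_sub_le (R : realFieldType) (N m l : nat) : (l <= m <= N)%N -> (0 < N)%N ->
  'C(N - l, m - l)%:R <= 'C(N, m)%:R * (m%:R / N%:R) ^+ l :> R.
Proof.
move=> + N0; elim: l => [|l IH] /andP[lm mN]; first by rewrite !subn0 mulr1.
have {}IH := IH; rewrite ltnW //= mN in IH; have {}IH := IH isT.
rewrite exprSr mulrA; apply: le_trans (ler_wpM2r _ IH); last by rewrite divr_ge0.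
have Nl0 : 0 < (N - l)%:R :> R by rewrite ltr0n subn_gt0 (leq_trans lm).
have eq : (N - l)%:R * 'C(N - l.+1, m - l.+1)%:R = (m - l)%:R * 'C(N - l, m - l)%:R :> R.
  rewrite -!natrM; congr _%:R.
  by have := mul_bin_diag (N - l) (m - l.+1); rewrite subnSK // -subnS.
rewrite -(ler_pM2l Nl0) eq mulrCA mulrC ler_wpM2l ?ler0n //.
rewrite mulrA ler_pdivlMr ?ltr0n // -!natrM ler_nat.
by have := leq_mul (leqnn l) mN; nia.
Qed.

Lemma sumr_draws (R : realFieldType) (T : finType) (A : {set T}) m (c : R) :
  \sum_(J : {set T} | (J \subset A) && (#|J| == m)) c = 'C(#|A|, m)%:R * c.
Proof.
rewrite sumr_const -cards_draws mulr_natl; congr (_ *+ _).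
by apply: eq_card => J; rewrite !inE.
Qed.

(** After division by the binomial, this bounds the mean of w(|I n J|) over a random m-set J.
    Overlaps up to [l0] are charged [w l0]. An overlap of size l > l0 is charged to the l-subset L =
    I n J of [I], and a union bound over all such L applies [bin_sub_le]. *)
Lemma sum_overlap_le (R : realFieldType) (T : finType) (A I : {set T}) (m l0 : nat)
    (w : nat -> R) : I \subset A -> #|I| = m -> (0 < m)%N ->
  {homo w : i j / (i <= j)%N >-> i <= j} -> (forall l, 0 <= w l) ->
  \sum_(J : {set T} | (J \subset A) && (#|J| == m)) w #|I :&: J|
    <= 'C(#|A|, m)%:R *
       (w l0 + \sum_(l0.+1 <= l < m.+1) 'C(m, l)%:R * (m%:R / #|A|%:R) ^+ l * w l).
Proof.
move=> sIA cI m0 w_homo w_ge0; pose M (J : {set T}) := (J \subset A) && (#|J| == m).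
rewrite (eq_bigl M) //.
have mA : (m <= #|A|)%N by rewrite -cI subset_leq_card.
have split J : w #|I :&: J| <= w l0 + \sum_(l0.+1 <= l < m.+1)
    (\sum_(L : {set T} | (L \subset I) && (#|L| == l)) (L \subset J)%:R) * w l.
  have [le|gt] := leqP #|I :&: J| l0.
    apply: le_trans (w_homo _ _ le) _; rewrite lerDl sumr_ge0 // => l _.
    by rewrite mulr_ge0 ?sumr_ge0.
  rewrite (bigD1_seq #|I :&: J|) ?iota_uniq //=; last first.
    by rewrite mem_index_iota gt ltnS -cI subset_leq_card ?subsetIl.
  rewrite (bigD1 (I :&: J)) ?subsetIl ?eqxx //= subsetIr mulrDl mul1r.
  rewrite addrCA -addrA lerDl !addr_ge0 ?mulr_ge0 ?sumr_ge0 // => i _.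
  by rewrite mulr_ge0 ?sumr_ge0.
apply: le_trans (ler_sum _ (fun J _ => split J)) _.
rewrite big_split /= mulrDr; apply: lerD.
  by rewrite sumr_draws.
rewrite exchange_big mulr_sumr /= big_nat [leRHS]big_nat; apply: ler_sum => l /andP[_ lm].
rewrite -mulr_suml !mulrA ler_wpM2r // exchange_big /=.
have -> : 'C(#|A|, m)%:R * 'C(m, l)%:R * (m%:R / #|A|%:R) ^+ l =
   \sum_(L : {set T} | (L \subset I) && (#|L| == l)) ('C(#|A|, m)%:R * (m%:R / #|A|%:R) ^+ l) :> R.
  by rewrite sumr_draws cI mulrCA mulrA.
apply: ler_sum => L /andP[sL /eqP cL].
have A0 : (0 < #|A|)%N by apply: leq_trans mA.
rewrite -natr_sum; apply: le_trans (_ : 'C(#|A| - l, m - l)%:R <= _); last first.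
  by apply: bin_sub_le => //; rewrite -ltnS lm.
rewrite ler_nat -cL; apply: leq_trans (card_draws_superset m (subset_trans sL sIA)).
rewrite -big_mkcondr sum1_card subset_leq_card //.
by apply/subsetP => J; rewrite !inE /M unfold_in.
Qed.

(** * The independence number: second moment and concentration *)

Section IndependentSets.
Variables (R : realFieldType) (n : nat) (p : R).
Implicit Types (A I J : {set 'I_n}) (E S : {set 'I_n * 'I_n}).

Definition indep E I := [disjoint E & setX I I].

Definition indepnum A E : nat := \max_(I : {set 'I_n} | (I \subset A) && indep E I) #|I|.

Lemma indepnumP A E m : reflect (exists I, [/\ I \subset A, indep E I & #|I| = m])
                          (m <= indepnum A E)%N.
Proof.
apply: (iffP idP) => [|[I [sI iI <-]]]; last first.
  by rewrite /indepnum; apply: leq_bigmax_cond; rewrite sI.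
have P0 : (set0 \subset A) && indep E set0.
  by rewrite sub0set; apply/pred0P => -[x y]; rewrite /= !inE /= andbF.
rewrite /indepnum (bigop.bigmax_eq_arg set0) //; case: arg_maxnP => // I /andP[sI iI] _.
rewrite -bin_gt0 -cards_draws => /card_gt0P[J]; rewrite inE => /andP[sJ /eqP cJ].
exists J; split=> //; first exact: subset_trans sI.
by apply: disjointWr iI; rewrite setXS.
Qed.

(** Deleting [y] from a largest independent set of [E] leaves a set that is independent in [E'].
    Grouping pairs by their second component puts every pair into exactly one block. *)
Lemma indepnum_lip A y E E' :
  E :\: [set e | e.2 == y] = E' :\: [set e | e.2 == y] ->
  (indepnum A E <= indepnum A E' + 1)%N.
Proof.
move=> eE; have /indepnumP[I [sI iI <-]] := leqnn (indepnum A E).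
rewrite addn1 (cardsD1 y) -addn1 addnC leq_add ?leq_b1 //.
apply/indepnumP; exists (I :\ y); split=> //.
  exact: subset_trans (subD1set _ _) sI.
apply/pred0P => e /=; apply/negbTE/negP => /andP[eE']; rewrite !inE => /andP[/andP[_ e1]].
case/andP=> ne2 e2; have : e \in E' :\: [set e | e.2 == y] by rewrite !inE ne2.
rewrite -eE !inE ne2 /= => eE1; have /pred0P/(_ e) := iI.
by rewrite /= eE1 !inE e1 e2.
Qed.

Hypotheses (p_ge0 : 0 <= p) (p_lt1 : p < 1).

(** Second moment method for the number of independent m-subsets of [A]. Two m-sets with l common
    vertices share C(l, 2) pairs, so they are both independent with probability (1 - p)^-C(l, 2)
    times the product of the two probabilities. [sum_overlap_le] averages this factor. *)
Lemma indep_second_moment S A m l0 :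
  S \subset pairs n -> pairs n :&: setX A A \subset S ->
  (0 < m <= #|A|)%N ->
  1 <= Pr p S (fun E => m <= indepnum A E)%N *
       ((1 - p) ^- 'C(l0, 2) +
        \sum_(l0.+1 <= l < m.+1)
           'C(m, l)%:R * (m%:R / #|A|%:R) ^+ l * (1 - p) ^- 'C(l, 2)).
Proof.
move=> sS sAS /andP[m0 mA]; set P := Pr _ _ _; set W := _ + _.
have q0 : 0 < 1 - p by rewrite subr_gt0.
pose B I := pairs n :&: setX I I.
pose M I := (I \subset A) && (#|I| == m).
pose X E : R := \sum_(I | M I) [disjoint E & B I]%:R.
have sB I : M I -> B I \subset S.
  by case/andP=> sI _; apply: subset_trans sAS; rewrite setIS // setXS.
have cM (c : R) : \sum_(I | M I) c = 'C(#|A|, m)%:R * c. exact: sumr_draws.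
have EX : Ex p S X = 'C(#|A|, m)%:R * (1 - p) ^+ 'C(m, 2).
  rewrite Ex_sum -cM; apply: eq_bigr => I MI.
  by rewrite [LHS](Pr_avoid p (sB I MI)) card_pairs_setX; case/andP: MI => _ /eqP ->.
have EX_gt0 : 0 < Ex p S X by rewrite EX mulr_gt0 ?exprn_gt0 // ltr0n bin_gt0.
have EX2 : Ex p S (fun E => X E ^+ 2) <= (Ex p S X) ^+ 2 * W.
  rewrite (eq_Ex p (g := fun E => \sum_(I | M I) \sum_(J | M J)
      [disjoint E & B I :|: B J]%:R)); last first.
    move=> E _; rewrite expr2 mulr_suml; apply: eq_bigr => I _.
    rewrite mulr_sumr; apply: eq_bigr => J _; rewrite -natrM mulnb.
    by rewrite -!setI_eq0 setIUr setU_eq0.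
  rewrite Ex_sum EX.
  have -> : ('C(#|A|, m)%:R * (1 - p) ^+ 'C(m, 2)) ^+ 2 * W
     = \sum_(I | M I) ((1 - p) ^+ 'C(m, 2)) ^+ 2 * ('C(#|A|, m)%:R * W).
    by rewrite cM; ring.
  apply: ler_sum => I MI; rewrite Ex_sum; have /andP[sI /eqP cI] := MI.
  have w_homo : {homo (fun l => (1 - p) ^- 'C(l, 2)) : i j / (i <= j)%N >-> i <= j}.
    move=> i j ij; rewrite lef_pV2 ?posrE ?exprn_gt0 //.
    by apply: ler_wiXn2l; [exact: ltW|rewrite gerBl|exact: leq_bin2l].
  have w_ge0 l : 0 <= (1 - p) ^- 'C(l, 2) by rewrite invr_ge0 exprn_ge0 // ltW.
  have := sum_overlap_le l0 sI cI m0 w_homo w_ge0; rewrite -/W => H.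
  apply: le_trans (ler_wpM2l _ H); last by rewrite sqr_ge0.
  rewrite mulr_sumr le_eqVlt; apply/orP; left; apply/eqP.
  apply: eq_bigr => J MJ; rewrite [LHS](Pr_avoid p (B := B I :|: B J)); last first.
    by rewrite subUset !sB.
  have cJ : #|J| = m by case/andP: MJ => _ /eqP.
  have := cardsUI (B I) (B J); rewrite /B -setIIr setX_setI !card_pairs_setX cI cJ -/(B I) -/(B J).
  move=> H'; rewrite -exprM muln2 -addnn -H' exprD mulfK // expf_neq0 // gt_eqF //.
have SM : (Ex p S X) ^+ 2 <= P * Ex p S (fun E => X E ^+ 2).
  apply: second_moment => //; first exact: ltW.
  move=> E sE; apply: contraNeq => X0; apply/indepnumP.
  have [I /andP[sI /eqP cI] dI] : exists2 I, M I & [disjoint E & B I].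
    apply/exists_inP; apply: contraNT X0; rewrite negb_exists_in => /forall_inP nI.
    by rewrite /X big1 // => I MI; rewrite (negPf (nI I MI)).
  exists I; split=> //; rewrite /indep -setI_eq0; apply: contraTT dI.
  case/set0Pn=> e; rewrite inE => /andP[eE eI]; rewrite -setI_eq0.
  by apply/set0Pn; exists e; rewrite in_setI eE inE eI (subsetP sS) ?(subsetP sE).
have P0 : 0 <= P by apply: Pr_ge0 => //; exact: ltW.
have := le_trans SM (ler_wpM2l P0 EX2).
by rewrite mulrCA -{1}[Ex p S X ^+ 2]mulr1 ler_pM2l ?exprn_gt0.
Qed.

(** [bounded_differences] with one block for each of the n vertices. Even an exponentially small
    lower bound at [m + t] forces the probability at [m] to be close to 1 when [t] is large
    enough. *)
Lemma indep_amplified S A m t (r : R) : 1 <= r ->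
  Pr p S (fun E => m + t <= indepnum A E)%N * (1 - Pr p S (fun E => m <= indepnum A E)%N)
    <= ((1 + r) ^+ 2 / (4 * r)) ^+ n / r ^+ t.
Proof.
move=> r1; rewrite -PrC [X in _ * X](_ : _ = Pr p S (fun E => indepnum A E < m)%N).
  have := @bounded_differences _ _ _ p_ge0 (ltW p_lt1) _ snd S (indepnum A) r r1.
  by rewrite card_ord; apply=> y E E' _ _; apply: indepnum_lip.
by apply: eq_Ex => E _; rewrite -ltnNge.
Qed.
End IndependentSets.

(** * Common neighbours and non-neighbours of a fixed set *)

Lemma card_ord_interval n a b : (b <= n)%N -> #|[set y : 'I_n | (a <= y < b)%N]| = (b - a)%N.
Proof.
move=> bn; rewrite -sum1dep_card -(big_mkord (fun i => (a <= i < b)%N) (fun=> 1%N)).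
rewrite -[RHS]muln1 -sum_nat_const_nat [RHS](big_nat_widenl a 0) //.
by rewrite [RHS](big_nat_widen 0 b n).
Qed.

(** A substitute for (1 - x)^s <= exp(-s x) that makes sense in any ordered field. The induction
    rests on (1 - x)(1 + (s + 1) x) <= 1 + s x. *)
Lemma expr1B_le_inv (R : realFieldType) (x : R) s : 0 <= x <= 1 ->
  (1 - x) ^+ s <= (1 + s%:R * x)^-1.
Proof.
case/andP=> x0 x1; have sx k : 0 < 1 + k%:R * x :> R by rewrite ltr_pwDl ?mulr_ge0.
rewrite -[leRHS]mul1r ler_pdivlMr //; elim: s => [|s IH]; first by rewrite mul0r addr0 mulr1.
apply: le_trans IH; rewrite exprSr -mulrA ler_wpM2l ?exprn_ge0 ?subr_ge0 //.
rewrite -subr_ge0 -natr1.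
have -> : 1 + s%:R * x - (1 - x) * (1 + (s%:R + 1) * x) = (s%:R + 1) * x ^+ 2 by ring.
by rewrite mulr_ge0 ?addr_ge0 ?sqr_ge0.
Qed.

Section Stars.
Variables (R : realFieldType) (T T' : finType) (p : R) (K : {set T}).
Implicit Types (S E : {set T * T'}) (Y : {set T'}).

(** The stars joining [K] to distinct vertices of [Y] consist of disjoint sets of pairs, so their
    completeness events are independent. *)
Lemma Pr_no_star Y :
  Pr p (setX K Y) (fun E => [forall y in Y, ~~ (setX K [set y] \subset E)])
    = (1 - p ^+ #|K|) ^+ #|Y|.
Proof.
elim: {Y}_.+1 {-2}Y (ltnSn #|Y|) => // k IH Y; rewrite ltnS => leY.
case: (set_0Vmem Y) => [->|[y yY]].
  rewrite cards0 expr0 -[RHS](Ex_cst p (setX K (@set0 T'))); apply: eq_Ex => E _.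
  by rewrite (_ : [forall _ in _, _]) //; apply/forall_inP => y; rewrite inE.
have ltY : (#|Y :\ y| < k)%N by rewrite (cardsD1 y Y) yY in leY.
have eY : setX K Y = setX K [set y] :|: setX K (Y :\ y).
  apply/setP => -[x z]; rewrite !inE /= -andb_orr.
  by case: (z =P y) => [->|_]; rewrite ?yY.
have dY : [disjoint setX K [set y] & setX K (Y :\ y)].
  by apply/pred0P => -[x z]; rewrite /= !inE /=; case: (z == y); rewrite ?andbF.
pose f E : R := (~~ (setX K [set y] \subset E))%:R.
pose g E : R := [forall z in Y :\ y, ~~ (setX K [set z] \subset E)]%:R.
rewrite {1}/Pr (eq_Ex p (g := fun E =>
   f (E :&: setX K [set y]) * g (E :&: setX K (Y :\ y)))); last first.
  move=> E _; rewrite /f /g -natrM mulnb subsetI subxx andbT; congr (nat_of_bool _)%:R.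
  have sz z : z \in Y :\ y ->
      (setX K [set z] \subset E :&: setX K (Y :\ y)) = (setX K [set z] \subset E).
    by move=> zY; rewrite subsetI [X in _ && X]setXS ?andbT ?sub1set.
  apply/forall_inP/andP => [H|[H1 /forall_inP H2] z zY].
    split; first exact: H.
    by apply/forall_inP => z zY; rewrite sz // H //; case/setD1P: zY.
  have [->//|zy] := eqVneq z y.
  have zY' : z \in Y :\ y by rewrite !inE zy.
  by rewrite -(sz z zY') H2.
rewrite eY (Ex_mul_setI p f g dY) [X in _ * X]IH //.
rewrite [X in X * _](_ : _ = 1 - p ^+ #|K|); first by rewrite (cardsD1 y Y) yY exprS.
have := Pr_superset p (subxx (setX K [set y])).
rewrite cardsX cards1 muln1 => <-.
rewrite -[1](Ex_cst p (setX K [set y])) /Pr -[X in _ + X]mulN1r -ExZ -ExD.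
by apply: eq_Ex => E _; rewrite /f; case: (_ \subset _); rewrite ?mulr1 ?mulr0 ?addr0 ?subrr.
Qed.

Hypotheses (p_ge0 : 0 <= p) (p_le1 : p <= 1).

Lemma Pr_star S Y : setX K Y \subset S ->
  1 - (1 + #|Y|%:R * p ^+ #|K|)^-1
    <= Pr p S (fun E => [exists y in Y, setX K [set y] \subset E]).
Proof.
move=> sS; rewrite lerBlDr -lerBlDl -PrC.
rewrite /Pr (eq_Ex p (g := fun E =>
  [forall y in Y, ~~ (setX K [set y] \subset E :&: setX K Y)]%:R)); last first.
  move=> E _; rewrite negb_exists_in; congr (nat_of_bool _)%:R.
  apply: eq_forallb_in => y yY; rewrite subsetI [X in _ && X]setXS ?andbT //.
  by rewrite sub1set.
rewrite (Ex_setI p (fun E => [forall y in Y, ~~ (setX K [set y] \subset E)]%:R)) //.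
by rewrite [leLHS]Pr_no_star expr1B_le_inv // exprn_ge0 //= exprn_ile1.
Qed.

(** Markov's inequality for twice the number of edges between [K] and [Y]: if fewer than half of the
    vertices of [Y] have no neighbour in [K], there are more than |Y| / 2 such edges. *)
Lemma Pr_few_neighbours S Y : setX K Y \subset S -> (0 < #|Y|)%N ->
  1 - 2 * p * #|K|%:R <=
  Pr p S (fun E => #|Y| <= 2 * #|[set y in Y | [disjoint E & setX K [set y]]]|)%N.
Proof.
move=> sS Y0; set P := fun E => _.
pose f E : R := \sum_(e in setX K Y) 2 * (e \in E)%:R.
have f0 E : E \subset S -> 0 <= f E by move=> _; rewrite sumr_ge0 // => e _; rewrite mulr_ge0.
have Ef : Ex p S f = 2 * p * #|K|%:R * #|Y|%:R.
  rewrite Ex_sum (eq_bigr (fun=> 2 * p)) => [|e eKY].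
    by rewrite sumr_const cardsX mulrnA !mulr_natr.
  rewrite ExZ; congr (_ * _).
  rewrite -[RHS](_ : p ^+ #|[set e]| = p); last by rewrite cards1 expr1.
  rewrite -(Pr_superset p (S := S)) ?sub1set ?(subsetP sS) //.
  by apply: eq_Ex => E _; rewrite sub1set.
suff Pf E : E \subset S -> ~~ P E -> #|Y|%:R <= f E.
  have := Ex_markov p_ge0 p_le1 f0 Pf; rewrite Ef mulrC ler_pM2r ?ltr0n //.
  by rewrite lerBlDr -lerBlDl.
move=> sE; rewrite /P -ltnNge; set G := [set y in Y | _] => GY.
rewrite /f -mulr_sumr -natr_sum -natrM ler_nat -big_mkcondr sum1_card.
have : (#|Y :\: G| <= #|[pred e in setX K Y | e \in E]|)%N.
  apply: leq_trans (leq_imset_card snd _); apply: subset_leq_card; apply/subsetP => y.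
  rewrite !inE => /andP[+ yY]; rewrite yY /= => /pred0Pn[[x z]]; rewrite /= !inE /=.
  case/and3P=> xE xK /eqP zy; apply/imsetP; exists (x, z); rewrite // !inE /=.
  by rewrite xK zy yY -zy.
have sG : G \subset Y by apply/subsetP => y; rewrite inE => /andP[].
rewrite cardsD (setIidPr sG); move: GY (subset_leq_card sG).
by move: #|Y| #|G| #|[pred _ in _ | _]| => u v w; lia.
Qed.
End Stars.

(** * A clique and an independent set with no edges between them *)

Section CliqueAndIndependentSet.
Variables (R : realFieldType) (n : nat) (p : R).
Implicit Types (A I K : {set 'I_n}) (E S : {set 'I_n * 'I_n}).

Definition clique E K :=
  [forall x in K, forall y in K, (x < y)%N ==> ((x, y) \in E)].

Lemma cliqueS E E' K : E \subset E' -> clique E K -> clique E' K.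
Proof.
move=> sE clK; apply/forall_inP => x xK; apply/forall_inP => y yK; apply/implyP => xy.
by rewrite (subsetP sE) // (implyP (forall_inP (forall_inP clK x xK) y yK)).
Qed.

Hypotheses (p_gt0 : 0 < p) (p_lt1 : p < 1).
Let p_ge0 := ltW p_gt0.
Let p_le1 := ltW p_lt1.

(** The clique starts at vertex 0 and gains one vertex from each successive interval of [s]
    vertices. A step exposes only pairs whose larger end lies in the new interval. Before each step
    the clique has at most [d] vertices, so a given vertex extends it with probability at least
    [p ^+ d]. *)
Lemma Pr_clique d s i : (i <= d)%N -> (1 + i * s <= n)%N ->
  (1 - (1 + s%:R * p ^+ d)^-1) ^+ i <=
  Pr p [set e in pairs n | e.2 < 1 + i * s]%N (fun E =>
    [exists K : {set 'I_n}, [&& #|K| == i.+1, [forall x in K, x < 1 + i * s]%N & clique E K]]).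
Proof.
have b0 : 0 <= 1 - (1 + s%:R * p ^+ d)^-1.
  have h : 1 <= 1 + s%:R * p ^+ d by rewrite lerDl mulr_ge0 ?exprn_ge0.
  by rewrite subr_ge0 invf_le1 // (lt_le_trans ltr01 h).
elim: i => [|i IH] id isn.
  rewrite expr0 -[leLHS](Ex_cst p [set e in pairs n | e.2 < 1 + 0 * s]%N).
  apply: le_Ex => // E _; rewrite (_ : [exists K, _]) //.
  apply/existsP; exists [set Ordinal isn]; rewrite cards1 eqxx /=; apply/andP; split.
    by apply/forall_inP => x; rewrite inE => /eqP ->.
  apply/forall_inP => x; rewrite inE => /eqP ->.
  by apply/forall_inP => y; rewrite inE => /eqP ->; rewrite ltnn.
set a := (1 + i * s)%N in IH *; have ea : (1 + i.+1 * s = a + s)%N by rewrite mulSn /a; lia.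
rewrite ea in isn *.
have eS : [set e in pairs n | e.2 < a + s]%N =
    [set e in pairs n | e.2 < a]%N :|: [set e in pairs n | a <= e.2 < a + s]%N.
  by apply/setP => -[x y]; rewrite !inE /= -andb_orr; case: (ltnP y a) => //= ya; rewrite ltn_addr.
rewrite eS exprSr; apply: Pr_setU => //; first 1 last.
- by apply: IH; [exact: ltnW|apply: leq_trans isn; rewrite leq_addr].
- move=> E sE /existsP[K /and3P[/eqP cK /forall_inP Ka clK]].
  pose Y := [set y : 'I_n | a <= y < a + s]%N.
  have cY : #|Y| = s by rewrite card_ord_interval // addKn.
  apply: le_trans (_ : _ <= 1 - (1 + #|Y|%:R * p ^+ #|K|)^-1) _.
    rewrite lerD2l lerN2 cY cK lef_pV2 ?posrE ?ltr_pwDl ?mulr_ge0 ?exprn_ge0 //.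
    by rewrite lerD2l ler_wpM2l // ler_wiXn2l.
  apply: le_trans (Pr_star p_ge0 p_le1 (S := [set e in pairs n | a <= e.2 < a + s]%N) _) _.
    apply/subsetP => -[x y]; rewrite !inE /= => /andP[/Ka xa /andP[ay ->]].
    by rewrite ay (leq_trans xa).
  apply: le_Pr => // F sF /exists_inP[y]; rewrite inE => /andP[ay yas] yF.
  apply/existsP; exists (y |: K).
  have yK : y \notin K by apply: contraL ay => /Ka; rewrite ltnNge.
  rewrite cardsU1 yK cK eqxx /=; apply/andP; split.
    apply/forall_inP => x; rewrite !inE => /orP[/eqP ->//|/Ka xa].
    exact: leq_trans xa (leq_addr _ _).
  apply/forall_inP => x xK; apply/forall_inP => z zK; apply/implyP => xz.
  move: xK zK xz; rewrite !inE => /orP[/eqP ->|xK] /orP[/eqP ->|zK].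
  + by rewrite ltnn.
  + by rewrite ltnNge (leq_trans _ ay) // ltnW // Ka.
  + by move=> _; rewrite (subsetP yF) ?orbT // !inE xK eqxx.
  + by move=> xz; rewrite (implyP (forall_inP (forall_inP clK x xK) z zK)).
by apply/pred0P => -[x y]; rewrite /= !inE /=; case: (ltnP y a); rewrite ?andbF.
Qed.

(** Requiring every vertex of [K] to precede every vertex of [I] makes the two sets disjoint, and
    leaves (x, y) as the only encoding of an edge between them. *)
Definition clique_and_indep d m E :=
  [exists K : {set 'I_n}, exists I : {set 'I_n},
    [&& #|K| == d.+1, #|I| == m, clique E K, indep E I &
      [forall x in K, forall y in I, (x < y)%N && ((x, y) \notin E)]]].

(** With a = 1 + d s, the pairs are exposed in three disjoint stages: both ends below a, which
    yields the clique; one end on each side, which yields the set [A] of its non-neighbours; both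
    ends at least a, which yields the independent set inside [A]. As [A] depends on the first two
    stages, the bound [c] is assumed for all large [A]. *)
Lemma Pr_clique_and_indep d s m (c : R) : (1 + d * s < n)%N -> 0 <= c ->
  2 * p * d.+1%:R <= 1 ->
  (forall A, (n - (1 + d * s) <= 2 * #|A|)%N ->
     (forall x, x \in A -> 1 + d * s <= x)%N ->
     c <= Pr p [set e in pairs n | 1 + d * s <= e.1]%N (fun E => m <= indepnum A E)%N) ->
  (1 - (1 + s%:R * p ^+ d)^-1) ^+ d * ((1 - 2 * p * d.+1%:R) * c)
    <= Pr p (pairs n) (clique_and_indep d m).
Proof.
move=> an c0 pd Pc; set a := (1 + d * s)%N in an Pc.
have eS : pairs n = [set e in pairs n | e.2 < a]%N :|:
   ([set e in pairs n | e.1 < a <= e.2]%N :|: [set e in pairs n | a <= e.1]%N).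
  apply/setP => -[x y]; rewrite !inE /= -!andb_orr.
  by case: (ltnP y a) => //= ay; case: (ltnP x a); rewrite ?andbT.
rewrite {1}eS; apply: Pr_setU => //; first 2 last.
- exact: (Pr_clique (leqnn d) (ltnW an)).
- move=> E1 sE1 /existsP[K /and3P[/eqP cK /forall_inP Ka clK]].
  pose Y := [set y : 'I_n | a <= y < n]%N.
  have cY : #|Y| = (n - a)%N by rewrite card_ord_interval.
  have Y0 : (0 < #|Y|)%N by rewrite cY subn_gt0.
  have sKY : setX K Y \subset [set e in pairs n | e.1 < a <= e.2]%N.
    apply/subsetP => -[x y]; rewrite !inE /= => /and3P[/Ka xa ay _].
    by rewrite xa ay (leq_trans xa).
  apply: Pr_setU => //; first 1 last.
  + by rewrite -cK; apply: (Pr_few_neighbours p_ge0 p_le1 sKY Y0).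
  + move=> E2 sE2; pose A := [set y in Y | [disjoint E2 & setX K [set y]]]; rewrite cY -/A => cA.
    have Aa x : x \in A -> (a <= x)%N by rewrite !inE => /andP[/andP[]].
    apply: le_trans (Pc A cA Aa) _; apply: le_Pr => // E3 sE3 /indepnumP[I [sI iI cI]].
    have Ia x : x \in I -> (a <= x)%N by move=> /(subsetP sI)/Aa.
    have s1 e : e \in E1 -> (e.2 < a)%N by move/(subsetP sE1); rewrite inE => /andP[].
    have s2 e : e \in E2 -> (e.1 < a)%N.
      by move/(subsetP sE2); rewrite inE => /andP[_ /andP[]].
    have s3 e : e \in E3 -> (a <= e.1)%N by move/(subsetP sE3); rewrite inE => /andP[].
    apply/existsP; exists K; apply/existsP; exists I; rewrite cK cI !eqxx /=.
    apply/and3P; split.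
    * by apply: cliqueS clK; rewrite subsetUl.
    * apply/pred0P => -[x y]; rewrite /= !inE /=; apply/negbTE/negP.
      case/andP=> + /andP[xI yI]; case/or3P=> [/s1|/s2|e3].
      - by rewrite /= ltnNge Ia.
      - by rewrite /= ltnNge Ia.
      by have /pred0P/(_ (x, y)) := iI; rewrite /= e3 !inE /= xI yI.
    apply/forall_inP => x xK; apply/forall_inP => y yI.
    rewrite (leq_trans (Ka x xK) (Ia y yI)) /= !inE !negb_or.
    apply/and3P; split.
    * by apply/negP => /s1; rewrite /= ltnNge Ia.
    * have := subsetP sI y yI; rewrite inE => /andP[_ /pred0P/(_ (x, y))].
      by rewrite /= !inE /= xK eqxx !andbT => ->.
    * by apply/negP => /s3; rewrite /= leqNgt Ka.
  by apply/pred0P => -[x y]; rewrite /= !inE /=; case: (ltnP x a); rewrite ?andbF.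
- apply/pred0P => -[x y]; rewrite /= !inE /=; case: (ltnP y a) => ya; rewrite ?andbF //=.
  by rewrite andbT; case: (ltnP x y) => //= xy; rewrite leqNgt (ltn_trans xy ya).
by rewrite mulr_ge0 // subr_ge0.
Qed.
End CliqueAndIndependentSet.

(** * Geometric realisation around a regular simplex *)

Lemma sum_sqr_axis_diag (R : comPzRingType) d (j k : 'I_d) (a a' b : R) :
  \sum_(i < d) (a * (i == j)%:R - a' * (i == k)%:R + b) ^+ 2
    = a ^+ 2 + a' ^+ 2 - 2 * a * a' * (j == k)%:R + 2 * b * (a - a') + d%:R * b ^+ 2.
Proof.
have delta (l : 'I_d) (F : 'I_d -> R) : \sum_i (i == l)%:R * F i = F l.
  rewrite (bigD1 l) //= eqxx mul1r big1 ?addr0 // => i /negPf ->.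
  by rewrite mul0r.
under eq_bigr => i _.
  have -> : (a * (i == j)%:R - a' * (i == k)%:R + b) ^+ 2 =
    (i == j)%:R * (a ^+ 2 - 2 * a * a' * (i == k)%:R + 2 * a * b)
    + (i == k)%:R * (a' ^+ 2 - 2 * a' * b) + b ^+ 2.
    by case: (i == j); case: (i == k) => /=; ring.
  over.
rewrite !big_split /= !delta sumr_const card_ord -mulr_natl; ring.
Qed.

(** [K] is placed at the unit vectors e_1, ..., e_d and at c (1, ..., 1), where c is the negative
    root of d c^2 = 2 c + 1, which makes all distances sqrt 2. The other vertices go to distinct
    points u e_1 with 0 < u < 1. The difference of two such points has the form a e_j - a' e_k + b
    (1, ..., 1), whose squared norm [sum_sqr_axis_diag] computes. *)
Lemma simplex_with_inner_points (R : rcfType) (d n : nat) (K : {set 'I_n}) :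
  (0 < d)%N -> #|K| = d.+1 ->
  exists f : 'I_n -> 'I_d -> R, forall x y, x != y ->
    let D := \sum_(i < d) (f x i - f y i) ^+ 2 in
    if (x \in K) && (y \in K) then D = 2 else 0 < D < 2.
Proof.
case: d => // d _ cK.
pose c : R := (1 - Num.sqrt d.+2%:R) / d.+1%:R.
have d0 : 0 < d.+1%:R :> R by rewrite ltr0n.
have c_quad : d.+1%:R * c ^+ 2 = 2 * c + 1.
  have s2 : Num.sqrt d.+2%:R ^+ 2 = d.+1%:R + 1 :> R by rewrite sqr_sqrtr ?natr1.
  have -> : 2 * c + 1 = d.+1%:R * c ^+ 2 - (Num.sqrt d.+2%:R ^+ 2 - (d.+1%:R + 1)) / d.+1%:R.
    rewrite /c; move: (Num.sqrt _) (d.+1%:R) d0 => s D D0.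
    by field; rewrite gt_eqF.
  by rewrite s2 subrr mul0r subr0.
have c_lt0 : c < 0.
  rewrite /c pmulr_llt0 ?invr_gt0 // subr_lt0 -[ltLHS]sqrtr1 ltr_sqrt ?ltr1n //.
pose idx x := index x (enum K).
have idx_le x : x \in K -> (idx x <= d.+1)%N.
  by move=> xK; rewrite -ltnS -cK cardE index_mem mem_enum.
have idx_inj x y : x \in K -> y \in K -> idx x = idx y -> x = y.
  move=> xK yK e; rewrite -(nth_index x (s := enum K) (x := x)) ?mem_enum // -/(idx x) e.
  by rewrite nth_index ?mem_enum.
pose del (x : 'I_n) : R := x.+2%:R^-1.
have del0 x : 0 < del x by rewrite invr_gt0 ltr0n.
have del1 x : del x < 1 by rewrite invf_lt1 ?ltr0n // ltr1n.
have del_inj x y : del x = del y -> x = y.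
  by move/invr_inj/eqP; rewrite eqr_nat => /eqP[/val_inj].
pose A x := if x \in K then (idx x < d.+1)%:R else del x.
(* For the last vertex of [K] the index is out of range and [inord] returns a default, which is
   harmless because [A x] is 0 there. *)
pose J x : 'I_d.+1 := if x \in K then inord (idx x) else ord0.
pose B x := if (x \in K) && (idx x == d.+1) then c else 0.
exists (fun x i => A x * (i == J x)%:R + B x) => x y xy D.
have {D}-> : D = A x ^+ 2 + A y ^+ 2 - 2 * A x * A y * (J x == J y)%:R
    + 2 * (B x - B y) * (A x - A y) + d.+1%:R * (B x - B y) ^+ 2.
  rewrite -sum_sqr_axis_diag; apply: eq_bigr => i _; congr (_ ^+ 2); ring.
have mixed z w : z \in K -> w \notin K ->
    0 < A z ^+ 2 + A w ^+ 2 - 2 * A z * A w * (J z == J w)%:R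
      + 2 * (B z - B w) * (A z - A w) + d.+1%:R * (B z - B w) ^+ 2 < 2.
  move=> zK wK; rewrite /A /B zK (negPf wK) /=.
  have := del0 w; have := del1 w; move: (del w) => u u1 u0.
  have /predU1P[iz|iz] : (idx z == d.+1) || (idx z < d.+1)%N by rewrite -leq_eqVlt idx_le.
    have c1 : 0 < - c * (1 - u) by rewrite mulr_gt0 // ?oppr_gt0 ?subr_gt0.
    have c2 : 0 < - c * u by rewrite mulr_gt0 ?oppr_gt0.
    have u2 : 0 < u * (1 - u) by rewrite mulr_gt0 ?subr_gt0.
    have uu : 0 < u * u by rewrite mulr_gt0.
    have : 0 <= d.+1%:R * c ^+ 2 by rewrite mulr_ge0 ?sqr_ge0.
    rewrite iz eqxx ltnn /= subr0 c_quad !expr2.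
    by move=> h; apply/andP; split; lra.
  have u2 : 0 < u * (1 - u) by rewrite mulr_gt0 ?subr_gt0.
  have uu : 0 < (1 - u) * (1 - u) by rewrite mulr_gt0 ?subr_gt0.
  rewrite iz ltn_eqF //= subr0 mulr0 mul0r addr0 expr0n mulr0 addr0 !expr2.
  by case: (J z == J w) => /=; apply/andP; split; lra.
case: ifP => [/andP[xK yK]|].
  have nxy : idx x != idx y by apply: contra_neq xy => /idx_inj; apply.
  rewrite /A /B xK yK /J xK yK /=.
  have inordE a b : (a < d.+1)%N -> (b < d.+1)%N ->
      ((inord a : 'I_d.+1) == inord b) = (a == b).
    by move=> ad bd; rewrite -val_eqE /= !inordK.
  have := idx_le x xK; rewrite leq_eqVlt => /predU1P[ix|ix];
  have := idx_le y yK; rewrite leq_eqVlt => /predU1P[iy|iy].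
  - by rewrite ix iy eqxx in nxy.
  - rewrite ix iy eqxx ltnn ltn_eqF //= subr0 c_quad; ring.
  - rewrite iy ix eqxx ltnn ltn_eqF //= sub0r sqrrN c_quad; ring.
  - rewrite ix iy !ltn_eqF //= inordE // (negPf nxy) /=; ring.
have [xK|xK] := boolP (x \in K); have [yK|yK] := boolP (y \in K) => // _.
- exact: mixed.
- have := mixed _ _ yK xK; rewrite (eq_sym (J y)).
  move: (A x) (A y) (B x) (B y) (J x == J y) d.+1%:R => a a' b b' e k.
  suff -> : a' ^+ 2 + a ^+ 2 - 2 * a' * a * e%:R + 2 * (b' - b) * (a' - a) + k * (b' - b) ^+ 2
    = a ^+ 2 + a' ^+ 2 - 2 * a * a' * e%:R + 2 * (b - b') * (a - a') + k * (b - b') ^+ 2 by [].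
  ring.
have := del0 x; have := del1 x; have := del0 y; have := del1 y.
have : del x != del y by apply: contra_neq xy => /del_inj.
rewrite /A /B /J (negPf xK) (negPf yK) /= subr0 -subr_eq0 -sqrf_eq0.
move: (del x) (del y) => u v uv v1 v0 u1 u0.
have : 0 < (u - v) ^+ 2 by rewrite lt_def uv sqr_ge0.
by move=> h; apply/andP; split; nra.
Qed.
End FiniteProbability.

Local Open Scope R_scope.

(** * Estimates for exponentials, binomials and the overlap sum *)

Lemma exp_pow x n : exp x ^ n = exp (INR n * x).
Proof.
elim: n => [|n IH]; first by rewrite /= Rmult_0_l exp_0.
by rewrite [LHS]/= IH -exp_plus S_INR; congr exp; lra.
Qed.

Lemma exp_le x y : x <= y -> exp x <= exp y.
Proof. by case=> [h|->]; [left; exact: exp_increasing|right]. Qed.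

Lemma exp_ge1D x : 1 + x <= exp x.
Proof. by case: (Req_dec x 0) => [->|/exp_ineq1]; [rewrite exp_0|]; lra. Qed.

(** The induction step is (1 + 1/k)^k <= e. *)
Lemma pow_le_exp_fact (l : nat) : INR l ^ l <= exp 1 ^ l * INR (l`!).
Proof.
elim: l => [|l IH]; first by rewrite fact0 /=; lra.
have e0 := exp_pos 1.
case: l IH => [|l] IH.
  by have := exp_ge1D 1; rewrite /=; lra.
set k := l.+1 in IH *.
have k0 : 0 < INR k by apply: lt_0_INR; lia.
have step : INR k.+1 ^ k <= exp 1 * INR k ^ k.
  have -> : INR k.+1 ^ k = (1 + / INR k) ^ k * INR k ^ k.
    by rewrite -Rpow_mult_distr S_INR; congr (_ ^ _); field; lra.
  apply: Rmult_le_compat_r; first by apply: pow_le; lra.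
  apply: Rle_trans (_ : exp (/ INR k) ^ k <= _).
    apply: pow_incr; split; last exact: exp_ge1D.
    by have := Rinv_0_lt_compat _ k0; lra.
  by rewrite exp_pow Rinv_r; lra.
have -> : INR (k.+1)`! = INR k.+1 * INR k`! by rewrite factS mult_INR.
have k1 : 0 < INR k.+1 by apply: lt_0_INR; lia.
rewrite -[INR k.+1 ^ k.+1]/(INR k.+1 * INR k.+1 ^ k) -[exp 1 ^ k.+1]/(exp 1 * exp 1 ^ k).
have := Rmult_le_compat_l _ _ _ (Rlt_le _ _ e0) IH.
move=> h; have := Rmult_le_compat_l _ _ _ (Rlt_le _ _ k1) (Rle_trans _ _ _ step h).
lra.
Qed.

Lemma bin_le_pow (m l : nat) : (0 < l)%N ->
  INR 'C(m, l) <= (exp 1 * (INR m / INR l)) ^ l.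
Proof.
move=> l0; have lR : 0 < INR l by apply: lt_0_INR; lia.
have f0 : 0 < INR l`! by apply: lt_0_INR; have := fact_gt0 l; lia.
have H : INR 'C(m, l) * INR l`! <= INR m ^ l.
  rewrite -mult_INR -[INR m ^ l]pow_INR; apply: le_INR.
  rewrite -[Nat.mul _ _]/('C(m, l) * l`!)%N bin_ffact.
  have -> : Nat.pow m l = (m ^ l)%N by elim: (l) => //= k ->; rewrite expnS.
  apply/ssrnat.leP; rewrite ffact_prod -[X in (_ <= _ ^ X)%N]card_ord -prod_nat_const.
  by apply: leq_prod => i _; exact: leq_subr.
have -> : (exp 1 * (INR m / INR l)) ^ l = INR m ^ l * (exp 1 ^ l / INR l ^ l).
  by rewrite /Rdiv !Rpow_mult_distr pow_inv; ring.
have ll : 0 < INR l ^ l by apply: pow_lt.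
have := pow_le_exp_fact l => h.
apply: (Rmult_le_reg_r (INR l`!)) => //.
apply: Rle_trans H _.
rewrite -{1}[INR m ^ l]Rmult_1_r Rmult_assoc; apply: Rmult_le_compat_l.
  by apply: pow_le; exact: pos_INR.
apply: (Rmult_le_reg_r (INR l ^ l)) => //.
have -> : exp 1 ^ l / INR l ^ l * INR l`! * INR l ^ l = exp 1 ^ l * INR l`! by field; lra.
lra.
Qed.

(** The factor of [indep_second_moment] for [N] = |A|: an upper bound for E X^2 / (E X)^2, where X
    counts the independent m-subsets. *)
Definition overlap_sum (p : R) (N m l0 : nat) : R :=
  (((1 - p) ^- 'C(l0, 2) +
    \sum_(l0.+1 <= l < m.+1)
       'C(m, l)%:R * (m%:R / N%:R) ^+ l * (1 - p) ^- 'C(l, 2))%R).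

Lemma inv_pow_bin_le (p sigma : R) (l : nat) : 0 < p < 1 -> 0 <= sigma ->
  / (1 - p) <= exp sigma ->
  / ((1 - p) ^ 'C(l, 2)) <= exp (sigma * INR l / 2) ^ l.
Proof.
move=> p01 s0 ps; have q0 : 0 < / (1 - p) by apply: Rinv_0_lt_compat; lra.
rewrite -pow_inv exp_pow; apply: Rle_trans (_ : exp sigma ^ 'C(l, 2) <= _).
  by apply: pow_incr; lra.
rewrite exp_pow; apply: exp_le.
have : 2 * INR 'C(l, 2) <= INR l * INR l.
  rewrite -mult_INR -[2]/(INR 2) -mult_INR; apply: le_INR; rewrite bin2.
  by have := odd_double_half (l * l.-1); nia.
by move: (INR 'C(l, 2)) => b hb; nra.
Qed.

Lemma sum_pow_le (x : R) a b : 0 <= x <= 1 / 2 -> (0 < a)%N ->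
  (\sum_(a <= l < b) x ^+ l)%R <= 2 * x.
Proof.
move=> x12 a0; apply: Rle_trans (_ : 2 * x ^ a <= _); last first.
  case: a a0 => // a _; rewrite /=; have : x ^ a <= 1 by rewrite -(pow1 a); apply: pow_incr; lra.
  have : 0 <= x ^ a by apply: pow_le; lra.
  by nra.
have xk k : 0 <= x ^ k by apply: pow_le; lra.
have [ba|/ltnW ab] := leqP b a.
  by rewrite big_geq //; have := xk a; rewrite -[0%R]/0; lra.
(* The subtracted term lets the induction on [b] go through, since x <= 1/2. *)
suff : (\sum_(a <= l < b) x ^+ l)%R <= 2 * (x ^ a - x ^ b) by have := xk b; lra.
rewrite -(subnKC ab); elim: (b - a)%N => [|k IH].
  by rewrite addn0 big_geq // -[0%R]/0; lra.
rewrite addnS big_nat_recr ?leq_addr //= -RpowE -[(_ + _)%R]/(_ + _).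
have := xk (a + k)%N.
move: IH; move: (\sum_(_ <= l < _) _)%R (x ^ (a + k)) (x ^ a) => u v w h v0; nra.
Qed.

(* [sigma] is an upper bound for [- ln (1 - p)]; by [C(m,l) <= (e m / l)^l] the
   [l]-th term is at most the [l]-th power of the left-hand side below. *)
Lemma overlap_sum_le (p sigma x : R) (N m l0 : nat) :
  0 < p < 1 -> 0 <= sigma -> / (1 - p) <= exp sigma -> 0 <= x <= 1 / 2 ->
  (forall l : nat, (l0 < l <= m)%N ->
     exp 1 * (INR m / INR l) * (INR m / INR N) * exp (sigma * INR l / 2) <= x) ->
  overlap_sum p N m l0 <= exp (sigma * INR l0 ^ 2 / 2) + 2 * x.
Proof.
move=> p01 s0 ps x12 hx; rewrite /overlap_sum -[(_ + _)%R]/(_ + _).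
apply: Rplus_le_compat.
  rewrite -RpowE -RinvE; apply: Rle_trans (inv_pow_bin_le l0 p01 s0 ps) _.
  by rewrite exp_pow; apply: exp_le; lra.
apply: Rle_trans (@sum_pow_le x l0.+1 m.+1 x12 isT).
apply/RleP; rewrite big_nat [leRHS]big_nat; apply: ler_sum => l /andP[l0l lm].
apply/RleP; rewrite -!INRE -!RpowE -RinvE -RdivE.
change (INR 'C(m, l) * (INR m / INR N) ^ l * / (1 - p) ^ 'C(l, 2) <= x ^ l).
have l1 : (0 < l)%N by apply: leq_trans l0l.
have h1 := bin_le_pow m l1.
have h2 := inv_pow_bin_le l p01 s0 ps.
have mN : 0 <= INR m / INR N.
  case: (N) => [|N']; first by rewrite /Rdiv /= Rinv_0; lra.
  by apply: Rle_mult_inv_pos; [exact: pos_INR|apply: lt_0_INR; lia].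
have mNl : 0 <= (INR m / INR N) ^ l by apply: pow_le.
apply: Rle_trans (_ : (exp 1 * (INR m / INR l)) ^ l * (INR m / INR N) ^ l *
   exp (sigma * INR l / 2) ^ l <= _).
  apply: Rmult_le_compat => //.
  - by apply: Rmult_le_pos => //; exact: pos_INR.
  - by left; apply: Rinv_0_lt_compat; apply: pow_lt; lra.
  - exact: Rmult_le_compat_r.
rewrite -!Rpow_mult_distr; apply: pow_incr; split; last by apply: hx; rewrite l0l.
have ml : 0 <= INR m / INR l.
  by apply: Rle_mult_inv_pos; [exact: pos_INR|apply: lt_0_INR; lia].
have e0 := exp_pos 1; have e1 := exp_pos (sigma * INR l / 2).
by repeat (apply: Rmult_le_pos; try lra).
Qed.

(** * Asymptotics of the overlap sum in L = ln n *)

Definition eventually (P : R -> Prop) := exists L0, forall L, L0 <= L -> P L.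

Lemma eventually_and P Q : eventually P -> eventually Q -> eventually (fun L => P L /\ Q L).
Proof.
move=> [a Pa] [b Qb]; exists (Rmax a b) => L hL; split.
  by apply: Pa; apply: Rle_trans hL; exact: Rmax_l.
by apply: Qb; apply: Rle_trans hL; exact: Rmax_r.
Qed.

Lemma eventually_imp (P Q : R -> Prop) :
  (forall L, P L -> Q L) -> eventually P -> eventually Q.
Proof. by move=> PQ [a Pa]; exists a => L /Pa /PQ. Qed.

Lemma eventually_ge a : eventually (fun L => a <= L).
Proof. by exists a. Qed.

(** exp(c L) >= (c L / 5)^5 outgrows L^4, the highest power that occurs in [overlap_sum_bound]. *)
Lemma eventually_exp_decay c K : 0 < c -> 0 <= K ->
  eventually (fun L => K * L ^ 4 * exp (- (c * L)) <= 1).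
Proof.
move=> c0 K0; exists (Rmax 1 (K * (5 / c) ^ 5)) => L hL.
have L1 : 1 <= L by apply: Rle_trans hL; exact: Rmax_l.
have LK : K * (5 / c) ^ 5 <= L by apply: Rle_trans hL; exact: Rmax_r.
have e0 := exp_pos (c * L); rewrite exp_Ropp.
apply: (Rmult_le_reg_r (exp (c * L))) => //.
rewrite Rmult_assoc Rinv_l; last lra.
have h : (c / 5 * L) ^ 5 <= exp (c * L).
  have -> : exp (c * L) = exp (c / 5 * L) ^ 5.
    by rewrite exp_pow; congr exp; rewrite /=; field.
  apply: pow_incr; split; last by have := exp_ge1D (c / 5 * L); lra.
  by apply: Rmult_le_pos; lra.
apply: Rle_trans (_ : _ <= 1 * (c / 5 * L) ^ 5) _; last lra.
have -> : 1 * (c / 5 * L) ^ 5 = L ^ 4 * ((c / 5) ^ 5 * L) by rewrite /=; ring.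
have -> : K * L ^ 4 * 1 = L ^ 4 * K by ring.
apply: Rmult_le_compat_l; first by apply: pow_le; lra.
have c5 : 0 < (c / 5) ^ 5 by apply: pow_lt; lra.
have -> : K = (c / 5) ^ 5 * (K * (5 / c) ^ 5).
  by rewrite /=; field; lra.
by apply: Rmult_le_compat_l; lra.
Qed.

Lemma eventually_exp_small c K : 0 < c -> 0 <= K ->
  eventually (fun L => K * exp (- (c * L)) <= 1).
Proof.
move=> c0 K0; apply: eventually_imp (eventually_and (eventually_ge 1) (eventually_exp_decay c0 K0)).
move=> L [L1 h]; apply: Rle_trans h; apply: Rmult_le_compat_r; first by left; exact: exp_pos.
rewrite -{1}[K]Rmult_1_r; apply: Rmult_le_compat_l => //.
by rewrite -(pow1 4); apply: pow_incr; lra.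
Qed.

Lemma nat_floor x : 0 <= x -> exists k : nat, INR k <= x < INR k + 1.
Proof.
move=> x0; have [h1 h2] := archimed x.
have up0 : Z.lt Z0 (up x) by apply: lt_IZR; lra.
have [k ek] := IZN (Z.sub (up x) (Zpos xH)) ltac:(lia).
by exists k; rewrite INR_IZR_INZ -ek minus_IZR; lra.
Qed.

(** With n = exp L, the dominant part is exp(sigma l0^2 / 2), whose exponent is of order n^-alpha +
    L^4 n^(3 alpha - 2) up to a factor n^(2 eta). It tends to 0 for alpha <= 3/5, and for alpha >
    3/5 it is at most n^(2 alpha - 1), since alpha < 1. The cut 3/5 lies below 2/3, where 3 alpha -
    2 changes sign, and above 1/2, where 2 alpha - 1 does. *)
Lemma overlap_sum_bound alpha C beta :
  0 < alpha < 1 -> 0 < C -> 0 < beta < 2 - 2 * alpha ->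
  eventually (fun L => forall (p : R) (N m : nat),
    exp (- (alpha * L)) < p < C * exp (- (alpha * L)) ->
    exp L / 4 <= INR N <= exp L -> INR m <= beta * L / p ->
    exists l0,
      (alpha <= 3 / 5 -> overlap_sum p N m l0 <= 5 / 4) /\
      (3 / 5 < alpha -> overlap_sum p N m l0 <= 2 * exp (exp ((2 * alpha - 1) * L)))).
Proof.
move=> [a0 a1] C0 [b0 b1].
(* [gam] is the margin left by beta < 2 - 2 alpha. Below, [eta] is small enough for a factor n^(2
   eta) to be absorbed by every negative exponent that occurs. *)
pose gam := 1 - alpha - beta / 2; have g0 : 0 < gam by rewrite /gam; lra.
have g1 : gam < 1 by rewrite /gam; lra.
pose eta := alpha * (1 - alpha) / 20.
have eta0 : 0 < eta by rewrite /eta; nra.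
have eta1 : eta <= alpha / 20 by rewrite /eta; nra.
have eta2 : eta <= (1 - alpha) / 20 by rewrite /eta; nra.
have K2 : 0 <= 4 * C / gam by apply: Rle_mult_inv_pos; lra.
have ev := eventually_and (eventually_ge 1) (eventually_and
  (eventually_exp_small a0 K2) (eventually_and
  (@eventually_exp_small eta 200 eta0 ltac:(lra)) (eventually_and
  (@eventually_exp_decay (gam / 2) 1000 ltac:(lra) ltac:(lra)) (eventually_and
  (@eventually_exp_small (alpha / 2) (100 * C) ltac:(lra) ltac:(lra)) (eventually_and
  (@eventually_exp_decay (1 / 10) 100000 ltac:(lra) ltac:(lra))
  (@eventually_exp_decay ((1 - alpha) / 2) 2000 ltac:(lra) ltac:(lra))))))).
apply: eventually_imp ev => L [L1 [E2 [E3 [E4 [E5 [E6 E7]]]]]] p N m [p1 p2] [N1 N2] mb.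
have p0 : 0 < p by have := exp_pos (- (alpha * L)); lra.
have NR0 : 0 < INR N by have := exp_pos L; lra.
have pg : p <= gam / 4.
  have : 4 / gam * p <= 4 * C / gam * exp (- (alpha * L)).
    have -> : 4 * C / gam * exp (- (alpha * L)) = 4 / gam * (C * exp (- (alpha * L))) by field; lra.
    apply: Rmult_le_compat_l; last lra.
    by apply: Rle_mult_inv_pos; lra.
  move=> h; have h' : 4 / gam * p <= 1 by lra.
  have -> : p = gam / 4 * (4 / gam * p) by field; lra.
  by nra.
have mR := pos_INR m.
have mp : INR m * p <= 2 * L.
  apply: Rle_trans (_ : beta * L / p * p <= _); first by apply: Rmult_le_compat_r; lra.
  have -> : beta * L / p * p = beta * L by field; lra.
  by nra.
have mpb : INR m * p <= beta * L.
  apply: Rle_trans (_ : beta * L / p * p <= _); first by apply: Rmult_le_compat_r; lra.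
  by right; field; lra.
have ip : / p <= exp (alpha * L).
  have -> : exp (alpha * L) = / exp (- (alpha * L)) by rewrite exp_Ropp Rinv_inv.
  by apply: Rinv_le_contravar; [exact: exp_pos|lra].
have ip0 : 0 < / p by exact: Rinv_0_lt_compat.
have iN : / INR N <= 4 * exp (- L).
  rewrite exp_Ropp; have -> : 4 * / exp L = / (exp L / 4).
    by have := exp_pos L; move=> h; field; lra.
  by apply: Rinv_le_contravar => //; have := exp_pos L; lra.
have iN0 : 0 < / INR N by exact: Rinv_0_lt_compat.
pose mu := INR m * INR m / INR N.
have mu0 : 0 <= mu by apply: Rle_mult_inv_pos => //; nra.
have eeta := exp_pos (eta * L).
have lam_ge0 : 0 <= exp (eta * L) * (1 + mu) by apply: Rmult_le_pos; lra.
(* The threshold exceeds the typical overlap [mu] by the factor [exp (eta L)],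
   which makes the larger overlaps negligible. *)
have [l0 [l0le l0gt]] := nat_floor lam_ge0.
have e3 := exp_le_3.
(* Once p <= gam / 4, this bounds -ln(1 - p) and costs only half of the margin [gam]. *)
pose sigma := (1 + gam / 2) * p.
have s0 : 0 <= sigma by rewrite /sigma; nra.
have s2 : sigma / 2 <= p by rewrite /sigma; nra.
have tail l : (l0 < l <= m)%N ->
    exp 1 * (INR m / INR l) * (INR m / INR N) * exp (sigma * INR l / 2) <= 1 / 20.
  case/andP=> l0l lm.
  have lR0 : 0 < INR l by apply: lt_0_INR; lia.
  have lR : INR l0 + 1 <= INR l by rewrite -S_INR; apply: le_INR; lia.
  have lmR : INR l <= INR m by apply: le_INR; lia.
  have il0 : 0 < / INR l by exact: Rinv_0_lt_compat.
  (* For l <= 1/p the exponential factor is bounded and mu / l <= n^-eta decides. For l > 1/p one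
     has m / l <= 2 L and m / N <= 8 L n^(alpha - 1), against an exponential of at most n^(1 - alpha
     - gam / 2). *)
  have [lp|lp] := Rle_lt_dec (INR l) (/ p).
    have h1 : exp (sigma * INR l / 2) <= exp 1.
      apply: exp_le; have : p * INR l <= 1.
        by rewrite -(Rinv_r p); [apply: Rmult_le_compat_l|]; lra.
      by nra.
    have h2 : INR m / INR l * (INR m / INR N) <= exp (- (eta * L)).
      have -> : INR m / INR l * (INR m / INR N) = mu * / INR l by rewrite /mu; field; lra.
      apply: (Rmult_le_reg_r (INR l)) => //; rewrite Rmult_assoc Rinv_l; last lra.
      rewrite exp_Ropp; apply: (Rmult_le_reg_l (exp (eta * L))) => //.
      have -> : exp (eta * L) * (/ exp (eta * L) * INR l) = INR l by field; lra.
      by nra.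
    have h2' : 0 <= INR m / INR l * (INR m / INR N).
      by apply: Rmult_le_pos; apply: Rle_mult_inv_pos.
    rewrite Rmult_assoc -/(Rdiv _ _).
    have -> : forall a b c d, a * b * (c * d) = a * d * (b * c) by move=> *; ring.
    have e1 := exp_pos 1; have e2 := exp_pos (sigma * INR l / 2).
    apply: Rle_trans (_ : 9 * exp (- (eta * L)) <= _); last lra.
    apply: Rmult_le_compat => //; first by nra.
    by nra.
  have h1 : INR m / INR l <= 2 * L.
    apply: Rle_trans mp; apply: Rmult_le_compat_l => //.
    by rewrite -[p]Rinv_inv; apply: Rinv_le_contravar => //; lra.
  have h2 : INR m / INR N <= 2 * L * exp (alpha * L) * (4 * exp (- L)).
    apply: Rmult_le_compat => //; [lra|].
    have -> : INR m = INR m * p * / p by field; lra.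
    by apply: Rmult_le_compat => //; nra.
  have h3 : exp (sigma * INR l / 2) <= exp ((1 - alpha - gam / 2) * L).
    apply: exp_le; have h : p * INR l <= beta * L by nra.
    have : sigma * INR l / 2 = (1 + gam / 2) * (p * INR l) / 2 by rewrite /sigma; field.
    have : (1 + gam / 2) * (p * INR l) <= (1 + gam / 2) * (beta * L).
      by apply: Rmult_le_compat_l; lra.
    have : (1 + gam / 2) * beta / 2 <= 1 - alpha - gam / 2 by rewrite /gam in g0 g1 *; nra.
    by nra.
  apply: Rle_trans (_ : 3 * (2 * L) * (2 * L * exp (alpha * L) * (4 * exp (- L))) *
     exp ((1 - alpha - gam / 2) * L) <= _).
    have e1 := exp_pos 1; have e2 := exp_pos (sigma * INR l / 2).
    have d1 : 0 <= INR m / INR l by apply: Rle_mult_inv_pos.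
    have d2 : 0 <= INR m / INR N by apply: Rle_mult_inv_pos.
    have d3 : 0 <= exp 1 * (INR m / INR l) by nra.
    have d4 : 0 <= exp 1 * (INR m / INR l) * (INR m / INR N) by nra.
    apply: Rmult_le_compat => //; first lra.
    apply: Rmult_le_compat => //.
    by apply: Rmult_le_compat => //; lra.
  have -> : 3 * (2 * L) * (2 * L * exp (alpha * L) * (4 * exp (- L))) *
     exp ((1 - alpha - gam / 2) * L) = 48 * L ^ 2 * exp (- (gam / 2 * L)).
    have -> : exp (- (gam / 2 * L)) = exp (alpha * L) * exp (- L) * exp ((1 - alpha - gam / 2) * L).
      by rewrite -!exp_plus; congr exp; ring.
    by ring.
  have L24 : L ^ 2 <= L ^ 4 by apply: Rle_pow => //; lia.
  have := exp_pos (- (gam / 2 * L)).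
  by move: (exp _) E4 => ee E4 ee0; nra.
exists l0; have p01 : 0 < p < 1 by lra.
have ps : / (1 - p) <= exp sigma.
  apply: Rle_trans (exp_ge1D sigma); apply: (Rmult_le_reg_r (1 - p)); first lra.
  rewrite Rinv_l; last lra.
  have : 0 <= p * (gam / 2 - (1 + gam / 2) * p) by apply: Rmult_le_pos; nra.
  by rewrite /sigma; nra.
have x12 : 0 <= 1 / 20 <= 1 / 2 by lra.
have bound := overlap_sum_le p01 s0 ps x12 tail.
(* Here (1 + mu)^2 <= 2 + 2 mu^2, and p mu^2 = (m p)^4 p^-3 N^-2 with m p <= 2 L. *)
have expo : sigma * INR l0 ^ 2 / 2 <=
    2 * C * exp (- (alpha / 2 * L)) + 512 * L ^ 4 * exp ((3 * alpha - 2 + 2 * eta) * L).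
  have l0R := pos_INR l0.
  set lam := exp (eta * L) * (1 + mu) in l0le lam_ge0.
  have : sigma * INR l0 ^ 2 / 2 <= p * lam ^ 2.
    have -> : sigma * INR l0 ^ 2 / 2 = sigma / 2 * INR l0 ^ 2 by field.
    apply: Rmult_le_compat => //; [lra|by apply: pow_le|by apply: pow_incr].
  have -> : p * lam ^ 2 = exp (2 * eta * L) * (p * (1 + mu) ^ 2).
    have -> : exp (2 * eta * L) = exp (eta * L) * exp (eta * L).
      by rewrite -exp_plus; congr exp; ring.
    by rewrite /lam; ring.
  have : p * (1 + mu) ^ 2 <= 2 * p + 2 * (p * mu ^ 2).
    have : 0 <= p * (1 - mu) ^ 2 by apply: Rmult_le_pos; [lra|exact: pow2_ge_0].
    by nra.
  have e2e := exp_pos (2 * eta * L).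
  have h1 : exp (2 * eta * L) * p <= C * exp (- (alpha / 2 * L)).
    apply: Rle_trans (_ : exp (2 * eta * L) * (C * exp (- (alpha * L))) <= _).
      by apply: Rmult_le_compat_l; lra.
    have -> : exp (2 * eta * L) * (C * exp (- (alpha * L))) =
       C * exp (2 * eta * L + - (alpha * L)) by rewrite exp_plus; ring.
    by apply: Rmult_le_compat_l; [lra|apply: exp_le; nra].
  have h2 : p * mu ^ 2 <= 256 * L ^ 4 * exp ((3 * alpha - 2) * L).
    have -> : p * mu ^ 2 = (INR m * p) ^ 4 * (/ p) ^ 3 * (/ INR N) ^ 2.
      by rewrite /mu; field; lra.
    have -> : 256 * L ^ 4 * exp ((3 * alpha - 2) * L) =
       (2 * L) ^ 4 * exp (alpha * L) ^ 3 * (4 * exp (- L)) ^ 2.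
      have -> : exp ((3 * alpha - 2) * L) = exp (alpha * L) ^ 3 * exp (- L) ^ 2.
        by rewrite !exp_pow -exp_plus; congr exp; rewrite /=; ring.
      by ring.
    have mp0 : 0 <= INR m * p by nra.
    apply: Rmult_le_compat; first by apply: Rmult_le_pos; apply: pow_le; lra.
    - by apply: pow_le; lra.
    - apply: Rmult_le_compat; try (by apply: pow_le; lra); apply: pow_incr; lra.
    by apply: pow_incr; lra.
  have -> : exp ((3 * alpha - 2 + 2 * eta) * L) = exp ((3 * alpha - 2) * L) * exp (2 * eta * L).
    by rewrite -exp_plus; congr exp; ring.
  have := Rmult_le_compat_l _ _ _ (Rlt_le _ _ e2e) h2.
  move: (exp (2 * eta * L)) (exp ((3 * alpha - 2) * L)) (p * mu ^ 2)
    (p * (1 + mu) ^ 2) e2e h1 => e4 e5 y z e2e h1 h3 h4 h5.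
  have := Rmult_le_compat_l _ _ _ (Rlt_le _ _ e2e) h4; lra.
have L4 : 0 <= L ^ 4 by apply: pow_le; lra.
split=> [a35|a35].
  have : 512 * L ^ 4 * exp ((3 * alpha - 2 + 2 * eta) * L) <= 512 * L ^ 4 * exp (- (1 / 10 * L)).
    by apply: Rmult_le_compat_l; [lra|apply: exp_le; nra].
  move=> h; have h1 : sigma * INR l0 ^ 2 / 2 <= 1 / 20 by lra.
  have h2 : exp (sigma * INR l0 ^ 2 / 2) <= 20 / 19.
    apply: Rle_trans (exp_le h1) _.
    have := exp_ge1D (- (1 / 20)); rewrite exp_Ropp => h3; have h4 := exp_pos (1 / 20).
    have := Rmult_le_compat_r _ _ _ (Rlt_le _ _ h4) h3; rewrite Rinv_l; lra.
  lra.
have big1 : 1 <= exp ((2 * alpha - 1) * L).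
  have : 0 <= (2 * alpha - 1) * L by apply: Rmult_le_pos; lra.
  by have := exp_ge1D ((2 * alpha - 1) * L); lra.
have : 512 * L ^ 4 * exp ((3 * alpha - 2 + 2 * eta) * L) <=
    512 * L ^ 4 * exp (- ((1 - alpha) / 2 * L)) * exp ((2 * alpha - 1) * L).
  rewrite [X in _ <= X]Rmult_assoc -exp_plus.
  by apply: Rmult_le_compat_l; [lra|apply: exp_le; nra].
move: (exp ((2 * alpha - 1) * L)) big1 => w w1 h.
have h1 : sigma * INR l0 ^ 2 / 2 <= w by nra.
have := exp_le h1; have := exp_ge1D w; lra.
Qed.

(** With r = exp lam the left-hand side is 1 + (r - 1)^2 / (4 r), where r - 1 <= lam r and r <= 3.
    This turns the constant of [kantorovich] into a Gaussian exponent. *)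
Lemma kantorovich_exp_le lam : 0 <= lam <= 1 ->
  (1 + exp lam) ^ 2 / (4 * exp lam) <= exp (lam ^ 2).
Proof.
move=> [l0 l1]; have e0 := exp_pos lam; have e1 := exp_ge1D lam.
have h : exp lam - 1 <= lam * exp lam.
  have := exp_ge1D (- lam); rewrite exp_Ropp => h.
  have := Rmult_le_compat_r _ _ _ (Rlt_le _ _ e0) h; rewrite Rinv_l; lra.
have e3 : exp lam <= 3 by have := exp_le l1; have := exp_le_3; lra.
apply: Rle_trans (exp_ge1D _); apply: (Rmult_le_reg_r (4 * exp lam)); first lra.
have -> : (1 + exp lam) ^ 2 / (4 * exp lam) * (4 * exp lam) = (1 + exp lam) ^ 2.
  by field; lra.
move: (exp lam) h e0 e1 e3 => r h e0 e1 e3.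
have : (r - 1) ^ 2 <= (lam * r) ^ 2 by apply: pow_incr; lra.
have : lam ^ 2 * r * (4 - r) >= 0.
  by apply: Rle_ge; repeat (apply: Rmult_le_pos; try lra); apply: pow2_ge_0.
by move=> *; nra.
Qed.

(** * Large independent sets with probability close to 1 *)

Section IndependentSets.
Variables (n : nat) (p : R) (S : {set 'I_n * 'I_n}) (A : {set 'I_n}).
Hypothesis p01 : 0 < p < 1.

Let P (m : nat) : R := Pr p S (fun E => m <= indepnum A E)%N.

Let p_ge0 : (0 <= p :> R)%R. Proof. by apply/RleP; case: p01 => /Rlt_le. Qed.
Let p_lt1 : (p < 1 :> R)%R. Proof. by apply/RltP; case: p01. Qed.

Lemma Pr_indepnum_ge m l0 : S \subset pairs n -> pairs n :&: setX A A \subset S ->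
  (0 < m <= #|A|)%N -> 1 <= P m * overlap_sum p #|A| m l0.
Proof.
by move=> sS sA mA; have /RleP := indep_second_moment p_ge0 p_lt1 l0 sS sA mA.
Qed.

Lemma Pr_indepnum_amplified m t lam : 0 <= lam <= 1 ->
  P (m + t) * (1 - P m) <= exp (INR n * lam ^ 2 - lam * INR t).
Proof.
move=> lam01; have e1 : (1 <= exp lam :> R)%R.
  by apply/RleP; change (1 <= exp lam); have := exp_ge1D lam; lra.
have /RleP := indep_amplified p_ge0 p_lt1 S A m t e1; rewrite -/(P _).
move=> h; apply: Rle_trans h _.
have e4 : (4%:R : R)%R = 4 by rewrite -INRE /=; lra.
rewrite e4 -!RpowE -!RdivE.
change (((1 + exp lam) ^ 2 / (4 * exp lam)) ^ n / exp lam ^ t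
  <= exp (INR n * lam ^ 2 - lam * INR t)).
have -> : exp (INR n * lam ^ 2 - lam * INR t) = exp (lam ^ 2) ^ n / exp lam ^ t.
  rewrite !exp_pow /Rminus exp_plus exp_Ropp; congr (_ * / exp _); ring.
apply: Rmult_le_compat_r.
  by left; apply: Rinv_0_lt_compat; apply: pow_lt; exact: exp_pos.
apply: pow_incr; split; last exact: kantorovich_exp_le.
have e0 := exp_pos lam; apply: Rle_mult_inv_pos; last lra.
exact: pow2_ge_0.
Qed.

Lemma Pr_indepnum_ge0 m : 0 <= P m.
Proof. by apply/RleP; apply: Pr_ge0 => //; exact: ltW. Qed.
End IndependentSets.

(** For alpha <= 3/5 the second moment suffices. Otherwise it is applied at m + t with t about 7
    n^alpha, which gives probability at least exp(-w) / 2 for w = n^(2 alpha - 1), and the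
    amplification carries this down to m with failure probability at most 2 exp(w - 49 w / 4). *)
Lemma Pr_indepnum_whp alpha C beta :
  0 < alpha < 1 -> 0 < C -> 0 < beta < 2 - 2 * alpha ->
  eventually (fun L => forall (p : R) n (S : {set 'I_n * 'I_n}) (A : {set 'I_n}) m,
    exp (- (alpha * L)) < p < C * exp (- (alpha * L)) -> INR n = exp L ->
    S \subset pairs n -> pairs n :&: setX A A \subset S ->
    exp L / 4 <= INR #|A| -> (0 < m)%N -> INR m <= beta * L / p ->
    4 / 5 <= Pr p S (fun E => m <= indepnum A E)%N).
Proof.
move=> [a0 a1] C0 [b0 b1].
(* The midpoint leaves room to replace [m] by the slightly larger [m + t]. *)
pose beta' := (beta + (2 - 2 * alpha)) / 2.
have b'b : beta < beta' < 2 - 2 * alpha by rewrite /beta'; lra.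
have b'1 : 0 < beta' < 2 - 2 * alpha by lra.
have ev := eventually_and (eventually_ge (Rmax 1 ((7 * C + 1) / (beta' - beta)))) (eventually_and
  (overlap_sum_bound (conj a0 a1) C0 (conj b0 b1)) (eventually_and
  (overlap_sum_bound (conj a0 a1) C0 b'1) (eventually_and
  (@eventually_exp_decay (1 - alpha) 100 ltac:(lra) ltac:(lra))
  (@eventually_exp_small alpha (2 * C) ltac:(lra) ltac:(lra))))).
apply: eventually_imp ev => L [Lge [H1 [H2 [E1 E2]]]] p n S A m [p1 p2] nL sS sA A1 m0 mb.
have L1 : 1 <= L by apply: Rle_trans Lge; exact: Rmax_l.
have Lb : (7 * C + 1) / (beta' - beta) <= L by apply: Rle_trans Lge; exact: Rmax_r.
have p0 : 0 < p by have := exp_pos (- (alpha * L)); lra.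
have p01 : 0 < p < 1 by lra.
have ip0 : 0 < / p by exact: Rinv_0_lt_compat.
have ip : / p <= exp (alpha * L).
  have -> : exp (alpha * L) = / exp (- (alpha * L)) by rewrite exp_Ropp Rinv_inv.
  by apply: Rinv_le_contravar; [exact: exp_pos|lra].
have eLa := exp_pos L.
have A2 : INR #|A| <= exp L.
  by rewrite -nL; apply: le_INR; have := max_card A; rewrite card_ord; lia.
have Ab : exp L / 4 <= INR #|A| <= exp L by [].
have small k b : 0 < b < 2 - 2 * alpha -> INR k <= b * L / p -> (k <= #|A|)%N.
  move=> [hb hb'] kb; apply/ssrnat.leP; apply: INR_le; apply: Rle_trans A1.
  apply: Rle_trans kb _; apply: Rle_trans (_ : 2 * L * exp (alpha * L) <= _).
    by apply: Rmult_le_compat => //; nra.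
  have -> : exp (alpha * L) = exp L * exp (- ((1 - alpha) * L)).
    by rewrite -exp_plus; congr exp; ring.
  have L4 : L <= L ^ 4 by rewrite -{1}[L]pow_1; apply: Rle_pow => //; lia.
  have := exp_pos (- ((1 - alpha) * L)); move: (exp (- _)) E1 => w E1 w0.
  have h : 8 * L * w <= 1.
    by have := Rmult_le_compat_r _ _ _ (Rlt_le _ _ w0) L4; nra.
  by have := Rmult_le_compat_l _ _ _ (Rlt_le _ _ eLa) h; lra.
have [a35|a35] := Rle_lt_dec alpha (3 / 5).
  have [l0 [/(_ a35) W _]] := H1 p _ m (conj p1 p2) Ab mb.
  have mA : (0 < m <= #|A|)%N by rewrite m0 (small m beta).
  have := Pr_indepnum_ge p01 l0 sS sA mA.
  have := Pr_indepnum_ge0 S A p01 m.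
  move: (Pr _ _ _) (overlap_sum _ _ _ _) W => x W hW x0 h.
  by nra.
(* The constant 7 makes t^2 / (4 n) >= 49 w / 4, well above the exponent w lost in the second
   moment; as w >= 1, the failure probability is at most 2/12. *)
have [t [t1 t2]] : exists t : nat, 7 * exp (alpha * L) <= INR t <= 7 * exp (alpha * L) + 1.
  have h : 0 <= 7 * exp (alpha * L) by have := exp_pos (alpha * L); lra.
  have [k hk] := nat_floor h.
  by exists k.+1; rewrite S_INR; lra.
have Cp : exp (alpha * L) <= C / p.
  apply: (Rmult_le_reg_r p) => //; have -> : C / p * p = C by field; lra.
  have : p * exp (alpha * L) <= C * exp (- (alpha * L)) * exp (alpha * L).
    by apply: Rmult_le_compat_r; [left; exact: exp_pos|lra].
  rewrite Rmult_assoc -exp_plus Rplus_opp_l exp_0; lra.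
(* As n^alpha <= C / p and 1 <= 1/p, t is at most (7 C + 1) / p, which is at most (beta' - beta) L /
   p for large L. *)
have mtb : INR (m + t) <= beta' * L / p.
  rewrite plus_INR.
  have h : 1 <= / p by rewrite -Rinv_1; apply: Rinv_le_contravar; lra.
  have -> : beta' * L / p = beta * L / p + (beta' - beta) * L * / p by field; lra.
  have : 7 * C + 1 <= (beta' - beta) * L.
    have -> : 7 * C + 1 = (beta' - beta) * ((7 * C + 1) / (beta' - beta)) by field; lra.
    by apply: Rmult_le_compat_l; lra.
  rewrite /Rdiv in Cp; move: (/ p) ip0 h Cp mb => ip' h1 h2 h3 h4 h5.
  have := Rmult_le_compat_r _ _ _ (Rlt_le _ _ h1) h5; lra.
have mtA : (0 < m + t <= #|A|)%N by rewrite (small _ beta') // addn_gt0 m0.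
have [l0 [_ /(_ a35) W]] := H2 p _ _ (conj p1 p2) Ab mtb.
have X1 := Pr_indepnum_ge p01 l0 sS sA mtA.
set w := exp ((2 * alpha - 1) * L) in W.
have w1 : 1 <= w.
  have : 0 <= (2 * alpha - 1) * L by apply: Rmult_le_pos; lra.
  by have := exp_ge1D ((2 * alpha - 1) * L); rewrite /w; lra.
have tn : INR t <= exp L.
  have : INR t <= INR #|A|.
    by apply: le_INR; case/andP: mtA => _; lia.
  lra.
(* This minimises n lam^2 - lam t, with value -t^2 / (4 n). *)
pose lam := INR t / (2 * exp L).
have lam01 : 0 <= lam <= 1.
  have tR := pos_INR t.
  split; first by apply: Rle_mult_inv_pos; lra.
  apply: (Rmult_le_reg_r (2 * exp L)); first lra.
  by rewrite /lam; have -> : INR t / (2 * exp L) * (2 * exp L) = INR t by [field; lra]; lra.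
have X2 := Pr_indepnum_amplified S A p01 m t lam01.
have expo : INR n * lam ^ 2 - lam * INR t <= - (49 / 4 * w).
  have -> : INR n * lam ^ 2 - lam * INR t = - (INR t ^ 2 / (4 * exp L)).
    by rewrite nL /lam; field; lra.
  apply: Ropp_le_contravar.
  have -> : w = exp (alpha * L) ^ 2 / exp L.
    by rewrite exp_pow /Rdiv -exp_Ropp -exp_plus /w; congr exp; rewrite /=; ring.
  have -> : 49 / 4 * (exp (alpha * L) ^ 2 / exp L) = (7 * exp (alpha * L)) ^ 2 / (4 * exp L).
    by field; lra.
  apply: Rmult_le_compat_r; first by left; apply: Rinv_0_lt_compat; lra.
  by apply: pow_incr; have := exp_pos (alpha * L); lra.
have {}X2 := Rle_trans _ _ _ X2 (exp_le expo).
have ew := exp_pos w.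
have Pmt : 1 <= Pr p S (fun E => m + t <= indepnum A E)%N * (2 * exp w).
  apply: Rle_trans X1 _; apply: Rmult_le_compat_l => //; exact: Pr_indepnum_ge0.
have P01 : 0 <= 1 - Pr p S (fun E => m <= indepnum A E)%N.
  apply/RleP; have /RltP pp0 := p0; have /RltP pp1 := proj2 p01.
  by have := Pr_ge0 (ltW pp0) (ltW pp1) S (fun E => ~~ (m <= indepnum A E)%N); rewrite PrC.
have : 1 - Pr p S (fun E => m <= indepnum A E)%N <= 2 * exp w * exp (- (49 / 4 * w)).
  apply: Rle_trans (_ : Pr p S (fun E => m + t <= indepnum A E)%N * (2 * exp w) *
     (1 - Pr p S (fun E => m <= indepnum A E)%N) <= _).
    by rewrite -{1}[1 - _]Rmult_1_l; apply: Rmult_le_compat_r.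
  rewrite Rmult_comm -Rmult_assoc Rmult_comm; apply: Rmult_le_compat_l; first lra.
  by rewrite Rmult_comm.
have -> : 2 * exp w * exp (- (49 / 4 * w)) = 2 * / exp (45 / 4 * w).
  by rewrite Rmult_assoc -exp_plus -exp_Ropp; congr (_ * exp _); field.
have big : 12 <= exp (45 / 4 * w) by have := exp_ge1D (45 / 4 * w); lra.
have : / exp (45 / 4 * w) <= / 12 by apply: Rinv_le_contravar; lra.
lra.
Qed.

(** * From the clique and the independent set to the event defining [u] *)

Lemma edistE d (x y : point d) :
  edist x y = sqrt (\sum_(i < d) (x i - y i) ^+ 2)%R.
Proof. by congr sqrt; apply: eq_bigr. Qed.

Lemma simplex_with_inner_points_edist d n (K : {set 'I_n}) :
  (0 < d)%N -> #|K| = d.+1 ->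
  exists f : 'I_n -> point d, forall x y, x <> y ->
    if (x \in K) && (y \in K) then edist (f x) (f y) = sqrt 2
    else 0 < edist (f x) (f y) < sqrt 2.
Proof.
move=> d0 cK; have [f Hf] := @simplex_with_inner_points R d n K d0 cK.
have e2 : (2%:R : R)%R = 2 by rewrite -INRE /=; lra.
exists f => x y /eqP xy; have := Hf x y xy; rewrite /= edistE e2.
case: ifP => [_ -> //|_ /andP[/RltP h0 /RltP h2]].
split; last by apply: sqrt_lt_1_alt; split=> //; exact: Rlt_le.
exact: sqrt_lt_R0.
Qed.

Lemma edist_refl d (x : point d) : edist x x = 0.
Proof.
rewrite edistE big1 ?sqrt_0 // => i _.
by rewrite -[(_ - _)%R]/(x i - x i) Rminus_diag expr0n.
Qed.

(** The graph induced on K u I is a complete graph on d + 1 vertices with isolated vertices added.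
    Its edges are exactly the pairs realised at distance sqrt 2, and its chromatic number is that of
    the clique. *)
Lemma clique_and_indep_event d n m (E : {set 'I_n * 'I_n}) : (0 < d)%N ->
  E \subset pairs n -> clique_and_indep d m E -> event_u d (d.+1 + m) E.
Proof.
move=> d0 sE /existsP[K /existsP[I /and5P[/eqP cK /eqP cI clK iI cross]]].
have ltE x y : (x, y) \in E -> (x < y)%N by move/(subsetP sE); rewrite inE.
have crossP x y : x \in K -> y \in I -> (x < y)%N /\ (x, y) \notin E.
  by move=> xK yI; apply/andP; apply: (forall_inP (forall_inP cross x xK)).
have dKI : [disjoint K & I].
  by apply/pred0P => x /=; apply/negbTE/negP => /andP[xK /(crossP x x xK)[]]; rewrite ltnn.
have adjI x y : x \in I -> y \in I -> adj E x y = false.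
  have nE u v : u \in I -> v \in I -> (u, v) \in E = false.
    move=> uI vI; apply/negP => uvE; have /pred0P/(_ (u, v)) := iI.
    by rewrite /= uvE !inE /= uI vI.
  by move=> xI yI; rewrite /adj !nE.
have adjKI x y : x \in K -> y \in I -> adj E x y = false.
  move=> xK yI; have [xy /negPf nE] := crossP x y xK yI; rewrite /adj nE /=.
  by apply/negP => /ltE; rewrite ltnNge ltnW.
have adjK x y : x \in K -> y \in K -> x <> y -> adj E x y.
  have cl u v : u \in K -> v \in K -> (u < v)%N -> (u, v) \in E.
    by move=> uK vK; apply/implyP; apply: (forall_inP (forall_inP clK u uK)).
  move=> xK yK nxy; rewrite /adj; case: (ltngtP x y) => [xy|yx|/val_inj //].
    by rewrite cl.
  by rewrite (cl y x) ?orbT.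
have adjC x y : adj E x y = adj E y x by rewrite /adj orbC.
have adjE x y : x \in K :|: I -> y \in K :|: I -> x <> y ->
    adj E x y = (x \in K) && (y \in K).
  have IK z : z \in I -> z \in K = false.
    by move=> zI; apply/negP => zK; have /pred0P/(_ z) := dKI; rewrite /= zK zI.
  rewrite !inE => /orP[xK|xI] /orP[yK|yI] nxy.
  - by rewrite xK yK adjK.
  - by rewrite adjKI // (IK y) ?andbF.
  - by rewrite adjC adjKI // (IK x).
  - by rewrite adjI // (IK x).
exists (K :|: I); split; first by rewrite cardsU (disjoint_setI0 dKI) cards0 subn0 cK cI.
have s20 : 0 < sqrt 2 by apply: sqrt_lt_R0; lra.
have K2 : (1 < #|K|)%N by rewrite cK ltnS.
split.
  have [f Hf] := simplex_with_inner_points_edist d0 cK.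
  exists f, (sqrt 2); split; [|split; [|split]].
  - move=> x y _ _ fxy; apply/eqP; apply: contraT => /eqP /Hf.
    by rewrite fxy edist_refl; case: ifP => _ ?; lra.
  - move=> x y _ _; have [->|/eqP/Hf] := eqVneq x y; first by rewrite edist_refl; lra.
    by case: ifP => _ ?; lra.
  - have /card_gt1P[x [y [xK yK /eqP xy]]] := K2; exists x, y.
    by rewrite !inE xK yK; have := Hf x y xy; rewrite xK yK.
  - move=> x y xW yW xy; rewrite adjE //; have := Hf x y xy.
    by case: ifP => _ h; split=> // ?; lra.
split.
  exists (fun x => if x \in K then index x (enum K) else 0%N); split=> [x _|x y xW yW xy].
    by case: ifP => // xK; rewrite -cK cardE index_mem mem_enum.
  have nxy : x <> y.
    by move=> exy; move: xy; rewrite exy /adj orbb => /ltE; rewrite ltnn.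
  move: xy; rewrite adjE // => /andP[xK yK]; rewrite xK yK => e; apply: nxy.
  rewrite -(nth_index x (s := enum K) (x := x)) ?mem_enum // e.
  by rewrite nth_index ?mem_enum.
move=> j jd [c [cj cadj]].
suff : (#|K| <= j)%N by rewrite cK leqNgt jd.
rewrite cardE -(size_map c) -[X in (_ <= X)%N](size_iota 0 j); apply: uniq_leq_size.
  rewrite map_inj_in_uniq ?enum_uniq // => x y; rewrite !mem_enum => xK yK cxy.
  apply/eqP; apply: contraT => /eqP nxy; exfalso; apply: (cadj x y) => //.
  - by rewrite inE xK.
  - by rewrite inE yK.
  - exact: adjK.
move=> _ /mapP[x + ->]; rewrite mem_enum mem_iota => xK.
by rewrite add0n /=; apply: cj; rewrite inE xK.
Qed.

Lemma Pr_le_prob n p (Q : pred {set 'I_n * 'I_n}) (A : {set 'I_n * 'I_n} -> Prop) :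
  0 <= p <= 1 -> (forall E : {set 'I_n * 'I_n}, E \subset pairs n -> Q E -> A E) ->
  Pr p (pairs n) Q <= prob p A.
Proof.
move=> [/RleP p0 /RleP p1] QA; apply/RleP; rewrite /prob /Pr /Ex.
apply: ler_sum => E sE; rewrite !RpowE; have h := wt_ge0 p0 p1 (pairs n) E.
case: excluded_middle_informative => [AE|nAE].
  by rewrite -[leRHS]mulr1; apply: ler_wpM2l => //; case: (Q E).
by rewrite (_ : Q E = false) ?mulr0 //; apply/negP => /(QA E sE).
Qed.

Lemma u_ge d n k p : (0 < k <= n)%N -> 1 / 2 < prob p (@event_u d n k) -> (k <= u d n p)%N.
Proof.
move=> /andP[k0 kn] hk; rewrite /u.
have kn' : (k < n.+1)%N by [].
apply: (@leq_bigmax_cond _ _ (fun i : 'I_n.+1 => nat_of_ord i) (Ordinal kn')).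
by rewrite /= k0 /Defs.Rltb; case: Rlt_dec.
Qed.

(** * Choice of parameters and conclusion *)

Lemma bernoulli_sub (y : R) d : 0 <= y <= 1 -> 1 - INR d * y <= (1 - y) ^ d.
Proof.
move=> y01; elim: d => [|d IH]; first by rewrite /=; lra.
rewrite S_INR -[(1 - y) ^ d.+1]/((1 - y) * (1 - y) ^ d).
have := Rmult_le_compat_l (1 - y) _ _ ltac:(lra) IH; have := pos_INR d.
move: ((1 - y) ^ d) (INR d) => a b b0 h; nra.
Qed.

(** With intervals of length s = floor(n / (4 d)), the clique search leaves enough vertices for a
    set [A] of size at least n / 4. Since alpha d < 1, s p^d grows without bound. The clique, its
    non-neighbours and the independent set each contribute a factor of at least 4/5, and (4/5)^3 =
    64/125 > 1/2. *)
Lemma clique_and_indep_whp d alpha C beta : (0 < d)%N ->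
  0 < alpha < 1 / INR d -> 0 < C -> 0 < beta < 2 - 2 * alpha ->
  eventually (fun L => forall (p : R) (n m : nat),
    exp (- (alpha * L)) < p < C * exp (- (alpha * L)) -> INR n = exp L ->
    (0 < m)%N -> INR m <= beta * L / p ->
    0 < p < 1 /\ 1 / 2 < Pr p (pairs n) (clique_and_indep d m)).
Proof.
move=> d0 [a0 ad] C0 b01.
have dR : 1 <= INR d by rewrite -[1]/(INR 1); apply: le_INR; lia.
have ad1 : alpha * INR d < 1.
  have -> : 1 = 1 / INR d * INR d by field; lra.
  by apply: Rmult_lt_compat_r; lra.
have a1 : alpha < 1 by nra.
have ev := eventually_and (eventually_ge (8 * INR d)) (eventually_and
  (Pr_indepnum_whp (conj a0 a1) C0 b01) (eventually_and
  (@eventually_exp_small (1 - alpha * INR d) (40 * INR d * INR d) ltac:(lra) ltac:(nra))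
  (@eventually_exp_small alpha (10 * INR d.+1 * C) a0
     ltac:(have := pos_INR d.+1; nra)))).
apply: eventually_imp ev => L [L8 [H [E1 E2]]] p n m [p1 p2] nL m0 mb.
have nL1 := exp_ge1D L.
have p0 : 0 < p by have := exp_pos (- (alpha * L)); lra.
have pd : 10 * INR d.+1 * p <= 1.
  apply: Rle_trans E2; rewrite Rmult_assoc [X in _ <= X]Rmult_assoc Rmult_assoc.
  apply: Rmult_le_compat_l; first lra.
  by apply: Rmult_le_compat_l; [exact: pos_INR|lra].
have d1R : INR d.+1 = INR d + 1 by rewrite S_INR.
have p01 : 0 < p < 1 by nra.
split=> //; pose s := (n %/ (4 * d))%N.
have sn : (4 * (d * s) <= n)%N by rewrite mulnA mulnC leq_trunc_div.
have n8 : (8 * d <= n)%N.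
  by apply/ssrnat.leP/INR_le; rewrite nL mult_INR /=; lra.
have sR : exp L <= 8 * INR d * INR s.
  have h : (n <= 8 * d * s)%N.
    have := divn_eq n (4 * d); have := ltn_pmod n (_ : 0 < 4 * d)%N; rewrite -/s.
    by move=> /(_ ltac:(lia)); nia.
  rewrite -nL; have -> : 8 * INR d * INR s = INR (8 * d * s) by rewrite !mult_INR /=; lra.
  by apply: le_INR; lia.
have spd : 5 * INR d <= INR s * p ^ d.
  have h1 : exp (- (alpha * INR d * L)) <= p ^ d.
    have -> : exp (- (alpha * INR d * L)) = exp (- (alpha * L)) ^ d.
      by rewrite exp_pow; congr exp; ring.
    by apply: pow_incr; have := exp_pos (- (alpha * L)); lra.
  have h2 : exp L * exp (- (alpha * INR d * L)) <= 8 * INR d * INR s * p ^ d.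
    by apply: Rmult_le_compat; try (by left; exact: exp_pos).
  have h3 : 40 * INR d * INR d <= exp L * exp (- (alpha * INR d * L)).
    have -> : exp L * exp (- (alpha * INR d * L)) = / exp (- ((1 - alpha * INR d) * L)).
      by rewrite -exp_plus -exp_Ropp; congr exp; ring.
    have e0 := exp_pos (- ((1 - alpha * INR d) * L)).
    apply: (Rmult_le_reg_r _ _ _ e0); rewrite Rinv_l; lra.
  by apply: (Rmult_le_reg_l (8 * INR d)); lra.
have /RltP pp0 := p0; have /RltP pp1 := proj2 p01.
have e2 : (2%:R : R)%R = 2 by rewrite -INRE /=; lra.
have := @Pr_clique_and_indep R n p pp0 pp1 d s m (Rdiv 4 5).
move=> /(_ ltac:(lia) ltac:(by apply/RleP; change (0 <= 4 / 5); lra)).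
rewrite e2 -!INRE -!RpowE -!RinvE.
move=> /(_ ltac:(by apply/RleP; change (2 * p * INR d.+1 <= 1); lra)) /(_ _)/RleP hh.
apply: Rlt_le_trans (hh _) => [|{hh} A cA Aa].
  change (1 / 2 < (1 - / (1 + INR s * p ^ d)) ^ d * ((1 - 2 * p * INR d.+1) * (4 / 5))).
  have y0 : 0 < / (1 + INR s * p ^ d) by apply: Rinv_0_lt_compat; lra.
  have y1 : INR d * / (1 + INR s * p ^ d) <= 1 / 5.
    apply: (Rmult_le_reg_r (1 + INR s * p ^ d)); first lra.
    rewrite Rmult_assoc Rinv_l; lra.
  have y2 : 4 / 5 <= (1 - / (1 + INR s * p ^ d)) ^ d.
    by apply: Rle_trans (bernoulli_sub _ _); [lra|nra].
  have : 4 / 5 * (4 / 5 * (4 / 5)) <=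
    (1 - / (1 + INR s * p ^ d)) ^ d * ((1 - 2 * p * INR d.+1) * (4 / 5)).
    by apply: Rmult_le_compat; lra.
  lra.
apply/RleP; apply: H => //.
- by apply/subsetP => e; rewrite inE => /andP[].
- by apply/subsetP => e; rewrite !inE => /and3P[-> /Aa ->].
rewrite -nL; have : INR n <= 4 * INR #|A|; last lra.
have -> : 4 * INR #|A| = INR (4 * #|A|) by rewrite mult_INR /=; lra.
by apply: le_INR; lia.
Qed.

Theorem theorem25 (d : nat) (alpha C : R) (p : nat -> R) :
  (1 <= d)%N ->
  (0 < alpha) -> (alpha < 1 / INR d) ->
  (0 < C) ->
  (exists N : nat, forall n : nat, (N <= n)%N ->
      (1 < p n * Rpower (INR n) alpha < C)) ->
  forall eps : R, (0 < eps) ->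
    exists n0 : nat, forall n : nat, (n0 <= n)%N ->
      (INR (u d n (p n)) >= (2 - 2 * alpha - eps) * ln (INR n) / p n).
Proof.
move=> d0 a0 ad C0 [N HN] eps eps0.
set beta := 2 - 2 * alpha - eps.
have pbound n : (N <= n)%N ->
    exp (- (alpha * ln (INR n))) < p n < C * exp (- (alpha * ln (INR n))).
  move=> /HN; rewrite /Rpower exp_Ropp; have := exp_pos (alpha * ln (INR n)).
  move: (exp _) => w w0 [h1 h2]; split.
    by apply: (Rmult_lt_reg_r w) => //; rewrite Rinv_l; lra.
  by apply: (Rmult_lt_reg_r w) => //; rewrite Rmult_assoc Rinv_l; lra.
have ln_ge L0 : exists n0 : nat, forall n : nat, (n0 <= n)%N -> 0 < INR n /\ L0 <= ln (INR n).
  have [k [_ hk]] := nat_floor (Rlt_le _ _ (exp_pos L0)).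
  exists k.+1 => n kn; have kR : INR k.+1 <= INR n by apply: le_INR; lia.
  rewrite S_INR in kR; have e0 := exp_pos L0; split; first lra.
  by rewrite -[L0]ln_exp; left; apply: ln_increasing; lra.
(* For beta <= 0 the claimed lower bound is not positive. *)
have [b0|b0] := Rle_lt_dec beta 0.
  have [n0 Hn0] := ln_ge 0; exists (maxn N n0) => n; rewrite geq_max => /andP[Nn n0n].
  have [_ L0] := Hn0 n n0n; have [p1 _] := pbound n Nn.
  have p0 : 0 < p n by have := exp_pos (- (alpha * ln (INR n))); lra.
  have ip := Rinv_0_lt_compat _ p0; apply: Rle_ge; apply: Rle_trans (pos_INR _).
  have : 0 <= - beta * ln (INR n) * / p n by repeat (apply: Rmult_le_pos; try lra).
  by rewrite /Rdiv; lra.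
have b01 : 0 < beta < 2 - 2 * alpha by rewrite /beta in b0 *; lra.
have K0 : 0 <= (INR d + 2) * C / beta.
  by apply: Rle_mult_inv_pos => //; have := pos_INR d; nra.
have [L0 HL] := eventually_and (eventually_ge 1) (eventually_and
  (clique_and_indep_whp d0 (conj a0 ad) C0 b01) (eventually_exp_small a0 K0)).
have [n0 Hn0] := ln_ge L0; exists (maxn N n0) => n; rewrite geq_max => /andP[Nn n0n].
have [n_gt0 /HL[L1 [H E]]] := Hn0 n n0n; have pb := pbound n Nn.
set L := ln (INR n) in L1 H E pb *.
have nL : INR n = exp L by rewrite exp_ln.
have [p1 p2] := pb; have p0 : 0 < p n by have := exp_pos (- (alpha * L)); lra.
have x_ge : INR d + 2 <= beta * L / p n.
  have : (INR d + 2) * p n <= beta.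
    apply: Rle_trans (_ : (INR d + 2) * (C * exp (- (alpha * L))) <= _).
      by apply: Rmult_le_compat_l; have := pos_INR d; lra.
    have -> : (INR d + 2) * (C * exp (- (alpha * L))) =
      beta * ((INR d + 2) * C / beta * exp (- (alpha * L))) by field; lra.
    by nra.
  move=> h; apply: (Rmult_le_reg_r (p n)) => //.
  have -> : beta * L / p n * p n = beta * L by field; lra.
  by nra.
have x0 : 0 <= beta * L / p n by have := pos_INR d; lra.
(* The independent set gets k - d vertices, so together with the clique there are k + 1 > beta L / p
   vertices. *)
have [k [k1 k2]] := nat_floor x0.
have dk : (d < k)%N by apply/ssrnat.ltP/INR_lt; lra.
have mR : INR (k - d) <= beta * L / p n by apply: Rle_trans k1; apply: le_INR; lia.
have [p01 Pm] := H (p n) n (k - d)%N pb nL ltac:(lia) mR.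
have ev (E0 : {set 'I_n * 'I_n}) :
    E0 \subset pairs n -> clique_and_indep d (k - d)%N E0 -> event_u d k.+1 E0.
  by move=> sE0 /(clique_and_indep_event d0 sE0); rewrite addSn subnKC // ltnW.
(* The maximum in [u] only ranges up to n. If k >= n, no vertex set of size k + 1 would exist and
   the event would have probability 0. *)
have kn : (k < n)%N.
  rewrite ltnNge; apply/negP => nk.
  suff : Pr (p n) (pairs n) (clique_and_indep d (k - d)%N) = 0 by lra.
  rewrite -[RHS](Ex_cst (p n) (pairs n)); apply: eq_Ex => E0 sE0.
  case: (boolP (clique_and_indep _ _ _)) => // /(ev E0 sE0)[W [cW _]].
  by have := max_card W; rewrite card_ord cW ltnNge nk.
have hu : (k.+1 <= u d n (p n))%N.
  apply: u_ge => //; apply: Rlt_le_trans Pm _; apply: Pr_le_prob => //; lra.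
apply: Rle_ge; apply: Rle_trans (_ : INR k.+1 <= _); last by apply: le_INR; lia.
by rewrite S_INR; lra.
Qed.
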